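(* Let $V$ be a positive definite quadratic space over $\mathbb{Q}$ with symmetric bilinear form $b$, $\varphi(v)=b(v,v)$, and let $L=\mathbb{Z}v_1+\cdots+\mathbb{Z}v_n$ be a lattice with $\mathbb{Q}L=V$, of even rank $n\geq 6$, whose Gram matrix is diagonal $\langle a_1,\dots,a_n\rangle$ with positive integers $a_j$ and $\gcd(a_1,\dots,a_n)=1$. Let $c\in\mathbb{Z}$, $N\in\mathbb{Z}_{>0}$ with $\gcd(c,N)=1$, $\nu=-\frac{c}{N}(v_1+\cdots+v_n)$, $X=L+\nu$, and let $h\in\mathbb{Q}$, $h\neq 0$, satisfy $h-\sum_{j=1}^n a_j(c/N)^2\in 8(\gcd(N,4)N)^{-1}\mathbb{Z}$. Let $p$ be an odd prime with $p\nmid N$, and write $L_p\cong\langle b_1p^{r_1},\dots,b_np^{r_n}\rangle$ with $b_i\in\mathbb{Z}_p^\times$ and $r_1\leq\cdots\leq r_n$. Suppose $[r_1,r_2,r_3,r_4]$ is one of: (1) $[0,0,0,i]$ with $i\geq 0$; (2) $[0,0,i,j]$ with $1\leq i\leq j$, where either $p\equiv 1\pmod 4$ and $\left(\frac{b_1b_2}{p}\right)=1$, or $p\equiv 3\pmod 4$ and $\left(\frac{b_1b_2}{p}\right)=-1$; (3) $[0,0,1,1]$, where either $p\equiv1\pmod 4$ and $\left(\frac{b_1b_2}{p}\right)=-1$, or $p\equiv 3\pmod 4$ and $\left(\frac{b_1b_2}{p}\right)=1$. Then there are positive constants $c_1(L)$ and $c_2(L)$ depending only on $L$ such that \[ c_1(L)\leq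 b_p(h,\lambda,0)\leq c_2(L). \]
   Context: For a prime $p$ let $V_p=V\otimes\mathbb{Q}_p$, $L_p=L\otimes\mathbb{Z}_p$, $X_p=L_p+\nu$, and let $\lambda_p$ be the characteristic function of $X_p$. For $z\in\mathbb{Q}_p$ set $\mathbf{e}_p(z):=e^{-2\pi i y}$ where $y\in\mathbb{Z}[1/p]$ with $z-y\in\mathbb{Z}_p$. Let $dv$ be the Haar measure on $V_p$ with $\int_{L_p}dv=1$ and $d\sigma$ the Haar measure on $\mathbb{Q}_p$ with $\int_{\mathbb{Z}_p}d\sigma=1$. The local density is $b_p(h,\lambda,0):=\int_{\mathbb{Q}_p}\int_{V_p}\mathbf{e}_p(\sigma(\varphi(v)-h))\lambda_p(v)\,dv\,d\sigma$. $\left(\frac{\cdot}{p}\right)$ is the Legendre symbol. *)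

(* Defs.v *)
From HB Require Import structures.
From mathcomp Require Import all_boot all_order all_algebra.
From mathcomp Require Import all_classical all_reals all_analysis.
From mathcomp Require Import complex.

Set Implicit Arguments.
Unset Strict Implicit.
Unset Printing Implicit Defensive.

Import Order.TTheory GRing.Theory Num.Theory.
Import numFieldNormedType.Exports.

Local Open Scope classical_set_scope.
Local Open Scope ring_scope.

(* Z_p is the inverse limit of the rings Z/p^k: [padic_res x k] is the residue of
   [x] modulo p^k, represented by an integer in [0, p^k). The coherence
   condition forces this range. *)
Record padic_int (p : nat) (hp : prime p) := PadicInt {
  padic_res : nat -> int;
  padic_resP : forall k, padic_res k = (padic_res k.+1 %% (p ^ k)%N%:Z)%Z }.
Arguments padic_res {p hp} _ _.

Section PadicIntegers.
Variables (p : nat) (hp : prime p).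
Local Notation Zp := (padic_int hp).
Local Notation q k := ((p ^ k)%N%:Z).
Implicit Types x y z : Zp.

HB.instance Definition _ := gen_eqMixin Zp.
HB.instance Definition _ := gen_choiceMixin Zp.

Lemma res_mod x k : (padic_res x k %% q k)%Z = padic_res x k.
Proof. by rewrite [in LHS](padic_resP x k) modz_mod -padic_resP. Qed.

Lemma eq_Zp x y : (forall k, (padic_res x k = padic_res y k %[mod q k])%Z) -> x = y.
Proof.
move=> E; have {}E : padic_res x = padic_res y.
  by apply/funext => k; rewrite -res_mod E res_mod.
case: x y E => [f hf] [g hg] /= E.
by case: _ / E hg => hg; rewrite (Prop_irrelevance hf hg).
Qed.

Definition coherent (f : nat -> int) :=
  forall k, (f k = f k.+1 %[mod q k])%Z.

Lemma modz_pS (m : int) k : ((m %% q k.+1)%Z = m %[mod q k])%Z.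
Proof.
apply/eqP; rewrite eqz_mod_dvd {1}/modz addrC addKr dvdzE abszN.
by rewrite abszM dvdn_mull //= dvdn_exp2l.
Qed.

Lemma of_coherent_subproof f : coherent f ->
  forall k, (f k %% q k)%Z = ((f k.+1 %% q k.+1)%Z %% q k)%Z.
Proof. by move=> hf k; rewrite modz_pS. Qed.

Definition of_coherent f (hf : coherent f) : Zp :=
  PadicInt hp (of_coherent_subproof hf).

Lemma resE f (hf : coherent f) k : padic_res (of_coherent hf) k = (f k %% q k)%Z.
Proof. by []. Qed.

Lemma coh_const m : coherent (fun=> m). Proof. by []. Qed.

Lemma coh_add x y : coherent (fun k => padic_res x k + padic_res y k).
Proof. by move=> k; rewrite (padic_resP x k) (padic_resP y k) modzDm. Qed.

Lemma coh_opp x : coherent (fun k => - padic_res x k).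
Proof. by move=> k; rewrite (padic_resP x k) modzNm. Qed.

Lemma coh_mul x y : coherent (fun k => padic_res x k * padic_res y k).
Proof. by move=> k; rewrite (padic_resP x k) (padic_resP y k) modzMm. Qed.

Definition Zp_of_int m := of_coherent (coh_const m).
Definition Zp_add x y := of_coherent (coh_add x y).
Definition Zp_opp x := of_coherent (coh_opp x).
Definition Zp_mul x y := of_coherent (coh_mul x y).

Let Zp_addA : associative Zp_add.
Proof.
by move=> x y z; apply: eq_Zp => k; rewrite !resE !modz_mod modzDml modzDmr addrA.
Qed.
Let Zp_addC : commutative Zp_add.
Proof. by move=> x y; apply: eq_Zp => k; rewrite !resE addrC. Qed.
Let Zp_add0 : left_id (Zp_of_int 0) Zp_add.
Proof. by move=> x; apply: eq_Zp => k; rewrite !resE mod0z add0r modz_mod. Qed.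
Let Zp_addN : left_inverse (Zp_of_int 0) Zp_opp Zp_add.
Proof.
by move=> x; apply: eq_Zp => k; rewrite !resE !modz_mod modzDml addNr.
Qed.

HB.instance Definition _ :=
  GRing.isZmodule.Build Zp Zp_addA Zp_addC Zp_add0 Zp_addN.

Let Zp_mulA : associative Zp_mul.
Proof.
by move=> x y z; apply: eq_Zp => k; rewrite !resE !modz_mod modzMml modzMmr mulrA.
Qed.
Let Zp_mulC : commutative Zp_mul.
Proof. by move=> x y; apply: eq_Zp => k; rewrite !resE mulrC. Qed.
Let Zp_mul1 : left_id (Zp_of_int 1) Zp_mul.
Proof.
by move=> x; apply: eq_Zp => k; rewrite !resE modz_mod modzMml mul1r.
Qed.
Let Zp_mulDl : left_distributive Zp_mul Zp_add.
Proof.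
move=> x y z; apply: eq_Zp => k.
by rewrite !resE !modz_mod modzMml modzDml modzDmr mulrDl.
Qed.
Let Zp_1neq0 : Zp_of_int 1 != 0.
Proof.
apply/eqP => /(congr1 (fun x => padic_res x 1)); rewrite !resE expn1 mod0z.
by rewrite modz_nat modn_small ?prime_gt1.
Qed.

HB.instance Definition _ := GRing.Zmodule_isComNzRing.Build Zp
  Zp_mulA Zp_mulC Zp_mul1 Zp_mulDl Zp_1neq0.

Definition Zp_unit : {pred Zp} := fun x => `[< exists y, y * x = 1 >].
Definition Zp_inv x : Zp :=
  if pselect (exists y, y * x = 1) is left e then projT1 (cid e) else x.

Let Zp_mulVx : {in Zp_unit, left_inverse 1 Zp_inv *%R}.
Proof.
move=> x; rewrite /in_mem /= => /asboolP ux; rewrite /Zp_inv.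
by case: pselect => // e; case: cid.
Qed.
Let Zp_unitPl x y : y * x = 1 -> Zp_unit x.
Proof. by move=> yx; apply/asboolP; exists y. Qed.
Let Zp_invr_out : {in [predC Zp_unit], Zp_inv =1 id}.
Proof.
move=> x /negP nux; rewrite /Zp_inv.
by case: pselect => // ux; case: nux; apply/asboolP.
Qed.

HB.instance Definition _ := GRing.ComNzRing_hasMulInverse.Build Zp
  Zp_mulVx Zp_unitPl Zp_invr_out.

Lemma Zp_neq0 x : x != 0 -> exists k, ~~ (q k %| padic_res x k)%Z.
Proof.
move=> x0; apply: contrapT => /forallNP H; move/eqP: x0; apply; apply: eq_Zp => k.
have /negP := H k; rewrite negbK => /dvdz_mod0P ->.
by rewrite -[0 in RHS]/(Zp_of_int 0) resE modz_mod mod0z.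
Qed.

Lemma res_mod_le x j k : (j <= k)%N -> (padic_res x k = padic_res x j %[mod q j])%Z.
Proof.
move=> /subnK <-; elim: (k - j)%N => //= m <-; rewrite addSn (padic_resP x (m + j)).
apply/eqP; rewrite eq_sym eqz_mod_dvd {1}/modz addrC addKr dvdzE abszN.
by rewrite abszM dvdn_mull //= dvdn_exp2l // leq_addl.
Qed.

Let Zp_mulf_eq0 x y : x * y = 0 -> (x == 0) || (y == 0).
Proof.
move=> xy0; apply/orP; case: (eqVneq x 0) => [|/Zp_neq0[i xi]]; first by left.
case: (eqVneq y 0) => [|/Zp_neq0[j yj]]; first by right.
have {}xi : ~~ (q i %| padic_res x (i + j))%Z.
  by apply: contra xi => /dvdz_mod0P H; apply/dvdz_mod0P;
     rewrite -H; apply/esym/res_mod_le/leq_addr.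
have {}yj : ~~ (q j %| padic_res y (i + j))%Z.
  by apply: contra yj => /dvdz_mod0P H; apply/dvdz_mod0P;
     rewrite -H; apply/esym/res_mod_le/leq_addl.
move: xy0 => /(congr1 (fun z => padic_res z (i + j))); rewrite !resE mod0z.
move=> /dvdz_mod0P; rewrite !dvdzE !absz_nat in xi yj *; rewrite abszM.
have pos u k : ~~ (p ^ k %| u)%N -> (0 < u)%N.
  by rewrite lt0n; apply: contraNneq => ->; rewrite dvdn0.
have x_gt0 := pos _ _ xi; have y_gt0 := pos _ _ yj.
rewrite !pfactor_dvdn ?muln_gt0 ?x_gt0 // lognM // => le_ij.
rewrite pfactor_dvdn // -ltnNge in xi; rewrite pfactor_dvdn // -ltnNge in yj.
by have := leq_trans (leq_add xi (ltnW yj)) le_ij; rewrite ltnn.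
Qed.

HB.instance Definition _ := GRing.ComUnitRing_isIntegral.Build Zp Zp_mulf_eq0.

Definition padic_residue x : 'F_p := (padic_res x 1)%:~R.

End PadicIntegers.

Definition legendre (F : finFieldType) (u : F) : int :=
  if u == 0 then 0 else if [exists y : F, y ^+ 2 == u] then 1 else -1.

(* Reserved to p-adic numbers, so that the topology declared below does not
   leak to other fraction fields. *)
Definition padic (p : nat) (hp : prime p) := {fraction (padic_int hp)}.

HB.instance Definition _ (p : nat) (hp : prime p) := GRing.Field.on (padic hp).

Section PadicNumbers.
Variables (p : nat) (hp : prime p).
Local Notation Zp := (padic_int hp).
Local Notation Qp := (padic hp).

Definition Zp_to_Qp : Zp -> Qp := @FracField.tofrac Zp.

HB.instance Definition _ := GRing.RMorphism.on Zp_to_Qp.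

Definition Qp_integers : set Qp := range Zp_to_Qp.

Definition Qp_open (U : set Qp) :=
  forall x, U x -> exists k : nat, forall z : Zp, U (x + p%:R ^+ k * Zp_to_Qp z).

Let Qp_openT : Qp_open setT.
Proof. by move=> x _; exists 0. Qed.

Let Qp_open_le x (U : set Qp) k l : (k <= l)%N ->
  (forall z : Zp, U (x + p%:R ^+ k * Zp_to_Qp z)) ->
  forall z : Zp, U (x + p%:R ^+ l * Zp_to_Qp z).
Proof.
move=> kl H z; have := H (p%:R ^+ (l - k) * z).
by rewrite rmorphM rmorphXn rmorph_nat mulrA -exprD subnKC.
Qed.

Let Qp_openI : setI_closed Qp_open.
Proof.
move=> A B oA oB x [/oA[k kA] /oB[l lB]]; exists (maxn k l) => z; split.
  exact: (Qp_open_le (leq_maxl k l)).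
exact: (Qp_open_le (leq_maxr k l)).
Qed.

Let Qp_open_bigU (I : Type) (f : I -> set Qp) :
  (forall i, Qp_open (f i)) -> Qp_open (\bigcup_i f i).
Proof. by move=> of_ x [i _ /of_[k H]]; exists k => z; exists i. Qed.

HB.instance Definition _ :=
  isOpenTopological.Build Qp Qp_openT Qp_openI Qp_open_bigU.
HB.instance Definition _ := isPointed.Build Qp 0.

End PadicNumbers.

Notation borel T := (g_sigma_algebraType (@open T)).

(* The Haar measure of a topological group with law [add], normalised to give
   mass 1 to the compact open subgroup [K]. *)
Definition haar_measure (R : realType) (T : ptopologicalType)
    (mu : {measure set (borel T) -> \bar R}) (add : T -> T -> T) (K : set T) :=
  (forall (A : set T) (x : T), measurable (A : set (borel T)) ->
     mu [set add x y | y in A] = mu A) /\ mu K = 1%E.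

Definition complex_integral (R : realType) d (T : measurableType d)
    (mu : {measure set T -> \bar R}) (f : T -> R[i]) : R[i] :=
  Complex (\int[mu]_x complex.Re (f x)) (\int[mu]_x complex.Im (f x)).

Definition Zinvp (p : nat) : set rat :=
  [set y | exists (m : int) (k : nat), y = m%:~R / p%:R ^+ k].

(* e^{-2 pi i y} for any y in Z[1/p] with z - y in Z_p; the value does not
   depend on the choice of y. *)
Definition e_p (R : realType) (p : nat) (hp : prime p) (z : padic hp) : R[i] :=
  let y := xget 0 [set y | Zinvp p y /\ Qp_integers (z - ratr y)] in
  let t : R := - (2%:R * pi * ratr y) in
  Complex (cos t) (sin t).

(* The quadratic space V over Q with bilinear form B, and the lattice L with
   basis v. V_p = V (x) Q_p is identified with row vectors of coordinates with
   respect to v (x) 1. *)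
Section Localization.
Variables (V : vectType rat) (n : nat) (v : n.-tuple V) (B : V -> V -> rat).
Variables (p : nat) (hp : prime p).
Local Notation Qp := (padic hp).

Definition localize (x : V) : 'rV[Qp]_n := \row_j ratr (coord v j x).

Definition gram_p : 'M[Qp]_n := \matrix_(i, j) ratr (B (tnth v i) (tnth v j)).

Definition phi_p (x : 'rV[Qp]_n) : Qp := (x *m gram_p *m x^T) 0 0.

Definition L_p : set 'rV[Qp]_n :=
  [set \sum_(j < n) Zp_to_Qp (z j) *: localize (tnth v j)
    | z in @setT ('I_n -> padic_int hp)].

Definition X_p (nu : V) : set 'rV[Qp]_n := [set l + localize nu | l in L_p].

(* L_p has a Z_p-basis, given by the rows of U, with Gram matrix <d_1, ..., d_n>. *)
Definition L_p_isometric_diag (d : 'I_n -> padic_int hp) :=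
  exists2 U : 'M[padic_int hp]_n, U \in unitmx &
    let W := map_mx (@Zp_to_Qp p hp) U in
    W *m gram_p *m W^T = diag_mx (\row_i Zp_to_Qp (d i)).

Definition local_density (R : realType)
    (muQ : {measure set (borel Qp) -> \bar R})
    (muV : {measure set (borel 'rV[Qp]_n) -> \bar R}) (nu : V) (h : rat) : R[i] :=
  complex_integral muQ (fun s =>
    complex_integral muV (fun x =>
      e_p R (s * (phi_p x - ratr h)) * \1_(X_p nu) x)).

End Localization.

Arguments Qp_integers {p} hp _.
Arguments L_p {V n} v {p} hp _.

(* Main.v *)
Require Import Defs.
From HB Require Import structures.
From mathcomp Require Import all_boot all_order all_algebra.
From mathcomp Require Import all_solvable all_field.
From mathcomp Require Import all_classical all_reals all_analysis.
From mathcomp Require Import measurable_realfun.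
From mathcomp Require Import complex.
From mathcomp Require Import zify ring lra.

Set Implicit Arguments.
Unset Strict Implicit.
Unset Printing Implicit Defensive.

Import Order.TTheory GRing.Theory Num.Theory.
Import numFieldNormedType.Exports.

Local Open Scope ring_scope.

(* Since p is prime to 2N, X_p = L_p and h is a p-adic integer.  Integrating
   first over p^-k Z_p, the local density is the limit of
   q^(1-n) #{x mod q : phi(x) = h mod q}, q = p^k.  The squared modulus of the
   n-dimensional Gauss sum at s/q, s a unit, is at most G q^-n with
   G = prod_j gcd(a_j, q); as n >= 6, the contributions of the shells
   |s| = p^k, k >= 1, are dominated by G p^(-2k), so the density differs from 1
   by at most G/8.  This gives the upper bound, and the lower bound when p does
   not divide A = prod_j a_j, since then G = 1.  The remaining p are at most A,
   so any lower bound depending only on p and A will do: each of the three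
   shapes of [r_1, ..., r_4] provides a solution modulo p^(e+1) with e <= r_5
   which is nonsingular after dividing by p^e, and Hensel's lemma turns it into
   at least p^((k-e)(n-1)) solutions modulo p^(k+1); finally p^r_5 divides A. *)

(** * Quadratic forms over finite prime fields *)

(** Uniformity in [h] is the difficulty. The Gauss sum bound has it because [h] enters only through
    a factor of modulus 1. The lower bound is delicate when [h] is highly divisible by [p]: a binary
    form anisotropic modulo [p] represents 0 only trivially, and in the third shape a pair of
    coordinates of equal exponent may be of this kind. Powers of [p] are therefore absorbed by
    scaling the exponent-0 or the exponent-1 pair, according to parity, but only up to [r_5]; there
    the fifth coordinate makes the form ternary, so the loss does not depend on [h]. The resulting
    bound [p^(-(r_5+1)(n-1))] is at least [A^(-A(n-1))] for [p] dividing [A], because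
    [r_5 < p^r_5 <= A]. The outer integral runs over a noncompact group, so it is the limit of the
    finite sums only once integrability is known; the shell estimate, applied to absolute values,
    supplies that too. *)

Lemma Fp_half_card (p : nat) : prime p -> odd p ->
  #|[set x : 'F_p | (x <= p./2)%N]| = p./2.+1.
Proof.
move=> hp op; have cp : #|'F_p| = p by rewrite card_Fp.
have ltp (x : 'F_p) : (x < p)%N by case: x => m /=; rewrite Fp_cast.
have h2 : (p./2 < p)%N by have := prime_gt1 hp; lia.
pose f (i : 'I_(p./2.+1)) : 'F_p := (i : nat)%:R.
have fE i : (f i : nat) = i.
  by rewrite /f val_Fp_nat // modn_small //; have := ltn_ord i; lia.
have finj : injective f.
  by move=> i j /(congr1 (fun x : 'F_p => (x : nat))); rewrite !fE => /val_inj.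
rewrite -[RHS]card_ord -cardsT -(card_imset _ finj); apply: eq_card => x.
rewrite inE; apply/idP/imsetP => [hx|[i _ ->]]; last first.
  by rewrite fE; have := ltn_ord i; lia.
have hx' : (x < p./2.+1)%N by lia.
exists (Ordinal hx') => //; apply: val_inj => /=.
by rewrite fE.
Qed.

(** The residues up to [(p - 1) / 2] represent ['F_p] modulo sign, which is all that squaring
    forgets. *)
Lemma Fp_sqr_inj (p : nat) : prime p -> odd p ->
  {in [set x : 'F_p | (x <= p./2)%N] &, injective (fun x => x ^+ 2)}.
Proof.
move=> hp op x y; rewrite !inE => hx hy /eqP; rewrite eqf_sqr => /orP[/eqP //|/eqP xy].
have : x + y = 0 by rewrite xy addNr.
move=> /(congr1 (fun x : 'F_p => (x : nat))) /=.
(* The representatives add up to at most [p - 1], so [x + y = 0] already holds in [nat]. *)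
rewrite modn_small; first last.
  by rewrite [X in (_ < X)%N]Fp_cast //; have := prime_gt1 hp; lia.
by move=> h; apply: val_inj => /=; lia.
Qed.

(* The sets {b1 x^2} and {t - b2 y^2} both have (p + 1) / 2 elements, so they meet. *)
Lemma Fp_binary_form_surj (p : nat) (b1 b2 t : 'F_p) : prime p -> odd p ->
  b1 != 0 -> b2 != 0 -> exists x y, b1 * x ^+ 2 + b2 * y ^+ 2 = t.
Proof.
move=> hp op b10 b20; set H := [set x : 'F_p | (x <= p./2)%N].
pose S1 := [set b1 * x ^+ 2 | x in H]; pose S2 := [set t - b2 * x ^+ 2 | x in H].
have c1 : #|S1| = p./2.+1.
  rewrite card_in_imset ?Fp_half_card // => x y hx hy /(mulfI b10).
  exact: Fp_sqr_inj.
have c2 : #|S2| = p./2.+1.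
  rewrite card_in_imset ?Fp_half_card // => x y hx hy.
  by move=> /addrI/oppr_inj/(mulfI b20); apply: Fp_sqr_inj.
have : S1 :&: S2 != finset.set0.
  rewrite -card_gt0; have := cardsUI S1 S2.
  have : (#|S1 :|: S2| <= p)%N by rewrite -[p in (_ <= p)%N](card_Fp hp) max_card.
  by rewrite c1 c2; lia.
case/finset.set0Pn => z /setIP[/imsetP[x _ ->] /imsetP[y _ e]].
by exists x, y; rewrite e subrK.
Qed.

(** The third variable is fixed first so that the binary form has to represent a nonzero [s]; this
    rules out [x = y = 0] even when [t = 0]. *)
Lemma Fp_ternary_form_surj (p : nat) (b1 b2 b3 t : 'F_p) : prime p -> odd p ->
  b1 != 0 -> b2 != 0 -> b3 != 0 ->
  exists x y z, b1 * x ^+ 2 + b2 * y ^+ 2 + b3 * z ^+ 2 = t /\ (x != 0) || (y != 0).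
Proof.
move=> hp op b10 b20 b30.
have [s [z [hs hz]]] : exists s z, s != 0 /\ s + b3 * z ^+ 2 = t.
  have [->|t0] := eqVneq t 0.
    by exists (- b3), 1; rewrite oppr_eq0 expr1n mulr1 addNr.
  by exists t, 0; rewrite expr0n mulr0 addr0.
have [x [y e]] := Fp_binary_form_surj s hp op b10 b20.
exists x, y, z; rewrite e; split => //.
apply: contraT; rewrite negb_or !negbK => /andP[/eqP x0 /eqP y0].
by move: hs; rewrite -e x0 y0 expr0n !mulr0 addr0 eqxx.
Qed.

Lemma Fp_sqr_euler (p : nat) (u : 'F_p) : prime p -> odd p -> u != 0 ->
  u ^+ p./2 = if [exists y : 'F_p, y ^+ 2 == u] then 1 else -1.
Proof.
move=> hp op u0; have p2 : (p./2).*2 = p.-1 by lia.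
have F1 (x : 'F_p) : x != 0 -> x ^+ p.-1 = 1.
  move=> x0; apply: (mulfI x0); rewrite mulr1 -exprS prednK ?prime_gt0 //.
  by have := expf_card x; rewrite card_Fp.
have sq1 : u ^+ p./2 = 1 \/ u ^+ p./2 = -1.
  have : (u ^+ p./2) ^+ 2 == 1 ^+ 2 by rewrite -exprM muln2 p2 F1 // expr1n.
  by rewrite eqf_sqr => /orP[]/eqP; [left|right].
case: existsP => [[y /eqP yu]|nex].
  have y0 : y != 0 by apply: contraNneq u0 => y0; rewrite -yu y0 expr0n.
  by rewrite -yu -exprM mul2n p2 F1.
case: sq1 => // u1; case: nex.
have : has p.-1.-primitive_root [seq x <- enum 'F_p | x != 0].
  apply: has_prim_root; first by have := prime_gt1 hp; lia.
  - by apply/allP => x; rewrite mem_filter => /andP[x0 _]; apply/unity_rootP/F1.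
  - by rewrite filter_uniq // enum_uniq.
  - have := card_Fp hp; rewrite cardE -(count_predC (fun x : 'F_p => x != 0)).
    rewrite size_filter [X in (_ + X)%N](_ : _ = 1)%N; last first.
      rewrite (@eq_count _ _ (pred1 0)); last by move=> x; apply: negbK.
      by rewrite count_uniq_mem ?enum_uniq // mem_enum.
    rewrite addn1 => h; by rewrite -ltnS prednK ?prime_gt0 // -{1}h.
case/hasP => g _ gp.
have [[i ilt] /= ui] := prim_rootP gp (F1 _ u0).
(* Euler's criterion through a primitive root: [p - 1] divides [i * (p - 1) / 2], so [i] is even and
   [g ^+ i./2] is a square root of [u]. *)
move: u1; rewrite ui -exprM => /eqP; rewrite -(prim_order_dvd gp) => di.
exists (g ^+ i./2); rewrite -exprM muln2.
have -> // : (i./2).*2 = i.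
suff : (2 %| i)%N by rewrite dvdn2 => ie; lia.
move: di; rewrite -p2 -mul2n dvdn_pmul2r //.
by have := prime_gt1 hp; case: (p) op => [|[|[|]]].
Qed.

(** Both alternatives say that [-u] has Legendre symbol 1, as [(-1)^((p-1)/2)] is 1 or -1 according
    to [p] modulo 4. For [u = b1 * b2] this is the isotropy of [b1 x^2 + b2 y^2]. *)
Lemma Fp_neg_sqr (p : nat) (u : 'F_p) : prime p ->
  (p %% 4 = 1)%N /\ legendre u = 1 \/ (p %% 4 = 3)%N /\ legendre u = -1 ->
  exists x, x ^+ 2 = - u.
Proof.
move=> hp H; have op : odd p by case: H => -[h _]; lia.
have u0 : u != 0 by apply/eqP => u0; move: H; rewrite /legendre u0 eqxx => -[[]|[]].
suff : (- u) ^+ p./2 = 1.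
  rewrite Fp_sqr_euler ?oppr_eq0 //; case: existsP => [[y /eqP <-]|_ /eqP]; first by exists y.
  rewrite eq_sym -addr_eq0 -[1 + 1]/(2%:R) -(dvdn_pcharf (pchar_Fp hp)).
  by rewrite dvdn_prime2 // => /eqP p2; rewrite p2 in op.
rewrite exprNn (@Fp_sqr_euler p u) // -signr_odd.
move: H; rewrite /legendre (negbTE u0).
by case: ifP => _ -[[h] | [h]] // _; have -> : odd p./2 = (p %% 4 == 3)%N by [lia];
  rewrite h /= ?expr0 ?expr1 ?mulr1 // mulrNN mulr1.
Qed.

(** * Counting points on diagonal quadrics modulo prime powers *)

Lemma prime_dvdzM (p : nat) (m n : int) : prime p ->
  (p %| m * n)%Z = (p %| m)%Z || (p %| n)%Z.
Proof. by move=> hp; rewrite !dvdzE abszM Euclid_dvdM. Qed.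

Lemma hensel_sqr (p : nat) (b x t : int) : prime p -> odd p ->
  ~~ (p %| b)%Z -> ~~ (p %| x)%Z -> (p %| b * x ^+ 2 - t)%Z ->
  forall k, exists y, (p%:Z ^+ k.+1 %| b * y ^+ 2 - t)%Z.
Proof.
move=> hp op pb px bx k.
(* The induction also carries [y] prime to [p], which keeps the derivative [2 b y] invertible. *)
suff [y []] : exists y, ~~ (p %| y)%Z /\ (p%:Z ^+ k.+1 %| b * y ^+ 2 - t)%Z by exists y.
elim: k => [|k [y [py /dvdzP[c hc]]]]; first by exists x.
have p2by : ~~ (p %| 2 * b * y)%Z.
  rewrite !prime_dvdzM // !negb_or pb py !andbT dvdzE /= dvdn_prime2 //.
  by apply: contraL op => /eqP ->.
have /coprimezP[[u v] /= uv] : coprimez p%:Z (2 * b * y).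
  by rewrite coprimezE /= prime_coprime // -dvdzE.
(* Newton's step: [v] inverts [2 b y] modulo [p], so the error [c p^(k+1)] is cancelled modulo
   [p^(k+2)]. *)
exists (y - p%:Z ^+ k.+1 * (c * v)); split.
  by rewrite rpredBr // exprS -mulrA dvdz_mulr ?dvdzz.
apply/dvdzP; exists (c * u + b * p%:Z ^+ k * (c * v) ^+ 2).
have -> : t = b * y ^+ 2 - c * p%:Z ^+ k.+1 by rewrite -hc; ring.
apply/eqP; rewrite -subr_eq0 !exprS; move: (p%:Z ^+ k) => P.
set z := (X in X == 0); have -> : z = c * (p%:Z * P) * (1 - (u * p%:Z + v * (2 * b * y))).
  by rewrite /z; ring.
by rewrite uv subrr mulr0.
Qed.

Lemma PoszX (m k : nat) : (m ^ k)%N%:Z = m%:Z ^+ k.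
Proof. by rewrite -!natz natrX. Qed.

Lemma Zp_intr_eq0 (q : nat) (m : int) : (1 < q)%N ->
  (m%:~R == 0 :> 'Z_q) = (q %| m)%Z.
Proof.
move=> q1; have natE (x : nat) : (x%:R == 0 :> 'Z_q) = (q %| x)%N.
  by rewrite -val_eqE /= val_Zp_nat.
rewrite dvdzE -natE; case: m => m; first by rewrite -pmulrn.
by rewrite NegzE abszN absz_nat mulrNz oppr_eq0.
Qed.

(* The coordinates other than the [i]-th are moved freely modulo [p ^ e.+1];
   the [i]-th one is then recovered by Hensel's lemma. *)
Lemma card_quadric_ge (p n k e m : nat) (i : 'I_n.+1) (d x : 'I_n.+1 -> int)
    (h b x' : int) : prime p -> odd p -> (e <= k)%N ->
  d i * p%:Z ^+ (2 * m) = b * p%:Z ^+ e -> x i = p%:Z ^+ m * x' ->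
  ~~ (p %| b)%Z -> ~~ (p %| x')%Z ->
  (p%:Z ^+ e.+1 %| \sum_j d j * x j ^+ 2 - h)%Z ->
  ((p ^ (k - e)) ^ n <=
    #|[set y : 'rV['Z_(p ^ k.+1)]_n.+1 |
        (\sum_j (d j)%:~R * y 0 j ^+ 2 == h%:~R)%R]|)%N.
Proof.
move=> hp op ek di xi pb px' hx.
have kE1 : (e + (k - e).+1)%N = k.+1 by rewrite addnS subnKC.
have kE2 : (e.+1 + (k - e))%N = k.+1 by rewrite addSn subnKC.
have P0 l : p%:Z ^+ l != 0 by rewrite expf_neq0 // -lt0n prime_gt0.
have q1 : (1 < p ^ k.+1)%N by rewrite -(exp1n k.+1) ltn_exp2r // prime_gt1.
have qE := PoszX p k.+1.
pose W := {ffun 'I_n -> 'I_(p ^ (k - e))}.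
have cW : #|{: W}| = ((p ^ (k - e)) ^ n)%N by rewrite card_ffun !card_ord.
pose z (w : W) (t : int) (j : 'I_n.+1) : int :=
  if unlift i j is Some j' then x j + p%:Z ^+ e.+1 * (w j' : nat)%:Z else t.
have ziE w t : z w t i = t by rewrite /z unlift_none.
have zlE w t j : z w t (lift i j) = x (lift i j) + p%:Z ^+ e.+1 * (w j : nat)%:Z.
  by rewrite /z liftK.
have /fin_all_exists[f hf] (w : W) : exists t : int,
    (p%:Z ^+ k.+1 %| \sum_j d j * z w t j ^+ 2 - h)%Z.
  pose S := \sum_(j < n) d (lift i j) * z w 0 (lift i j) ^+ 2.
  have SE t : \sum_j d j * z w t j ^+ 2 = d i * t ^+ 2 + S.
    rewrite (bigD1_ord i) //= ziE; congr (_ + _).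
    by apply: eq_bigr => j _; rewrite !zlE.
  have /dvdzP[c hc] : (p%:Z ^+ e.+1 %| d i * x i ^+ 2 + S - h)%Z.
    have -> : d i * x i ^+ 2 + S - h = (\sum_j d j * x j ^+ 2 - h) +
       (S - \sum_(j < n) d (lift i j) * x (lift i j) ^+ 2).
      by rewrite [in RHS](bigD1_ord i) //=; ring.
    apply: rpredD hx _; rewrite -sumrB; apply: rpred_sum => j _.
    rewrite zlE; apply/dvdzP; set u := _ ^+ e.+1; set v := (w j)%:Z.
    by exists (d (lift i j) * (v * (2 * x (lift i j) + u * v))); ring.
  have dP u : d i * (p%:Z ^+ m * u) ^+ 2 = p%:Z ^+ e * (b * u ^+ 2).
    by rewrite exprMn -exprM [(m * 2)%N]mulnC [LHS]mulrA di; ring.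
  (* After division by [p^e] the equation for the [i]-th coordinate has the simple root [x'] modulo
     [p]. *)
  have hS : h - S = p%:Z ^+ e * (b * x' ^+ 2 - c * p%:Z).
    rewrite mulrBr -dP -xi.
    have -> : p%:Z ^+ e * (c * p%:Z) = c * p%:Z ^+ e.+1 by rewrite exprSr; ring.
    by rewrite -hc; ring.
  have [y hy] : exists y, (p%:Z ^+ (k - e).+1 %| b * y ^+ 2 - (b * x' ^+ 2 - c * p%:Z))%Z.
    by apply: (hensel_sqr (x := x')) => //; rewrite opprB addrCA subrr addr0 dvdz_mull.
  exists (p%:Z ^+ m * y); rewrite SE -addrA -[S - h]opprB hS dP -mulrBr.
  by rewrite -[in X in (X %| _)%Z]kE1 exprD dvdz_mul2l.
pose F (w : W) : 'rV['Z_(p ^ k.+1)]_n.+1 := \row_j (z w (f w) j)%:~R.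
(* Only the free coordinates are compared: [w j < p^(k-e)] is scaled by [p^(e+1)], and
   [(e+1) + (k-e) = k+1], so nothing wraps around. *)
have Finj : injective F.
  move=> w w' /matrixP ww; apply/ffunP => j; apply: val_inj => /=.
  have := ww 0 (lift i j); rewrite !mxE => /eqP.
  rewrite -subr_eq0 -rmorphB /= Zp_intr_eq0 // qE !zlE.
  rewrite opprD addrACA subrr add0r -mulrBr -[in X in (X %| _)%Z]kE2 exprD dvdz_mul2l //.
  rewrite -eqz_mod_dvd -PoszX !modz_nat !modn_small //.
  by move=> /eqP [].
rewrite -cW -cardsT -(card_imset _ Finj); apply/subset_leq_card/fintype.subsetP.
move=> _ /imsetP[w _ ->]; rewrite inE -subr_eq0.
rewrite (_ : _ - _ = (\sum_j d j * z w (f w) j ^+ 2 - h)%:~R); last first.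
  rewrite rmorphB rmorph_sum; congr (_ - _); apply: eq_bigr => j _.
  by rewrite mxE rmorphM rmorphXn.
by rewrite Zp_intr_eq0 // qE.
Qed.

Lemma dvdz_Fp (p : nat) (m : int) : prime p -> (p %| m)%Z = (m%:~R == 0 :> 'F_p).
Proof. by move=> hp; rewrite -(dvdz_pcharf (pchar_Fp hp)). Qed.

Lemma intr_Fp (p : nat) (x : 'F_p) : (x : nat)%:Z%:~R = x.
Proof. by rewrite -pmulrn natr_Zp. Qed.

(* A solution modulo [p] of a ternary subform, scaled by [p ^ e], is nonsingular
   along [i1] or [i2]. *)
Lemma card_diag_quadric_ge (p n k e m m3 : nat) (i1 i2 i3 : 'I_n.+1)
    (b : 'I_n.+1 -> int) (r : 'I_n.+1 -> nat) (t : int) (x1 x2 x3 : 'F_p) :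
  prime p -> odd p -> (e <= k)%N -> uniq [:: i1; i2; i3] ->
  (forall j, ~~ (p %| b j)%Z) ->
  (r i1 + 2 * m)%N = e -> (r i2 + 2 * m)%N = e ->
  x3 = 0 \/ (r i3 + 2 * m3)%N = e ->
  (b i1)%:~R * x1 ^+ 2 + (b i2)%:~R * x2 ^+ 2 + (b i3)%:~R * x3 ^+ 2 = t%:~R ->
  (x1 != 0) || (x2 != 0) ->
  ((p ^ (k - e)) ^ n <=
    #|[set y : 'rV['Z_(p ^ k.+1)]_n.+1 |
        (\sum_j (b j * p%:Z ^+ r j)%:~R * y 0 j ^+ 2 == (p%:Z ^+ e * t)%:~R)%R]|)%N.
Proof.
move=> hp op ek /=; rewrite !inE !negb_or !andbT.
move=> /andP[/andP[i12 i13] i23] pb r1 r2 r3 hx x12.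
pose z (x : 'F_p) := (x : nat)%:Z.
pose x j : int := if j == i1 then p%:Z ^+ m * z x1 else if j == i2 then p%:Z ^+ m * z x2
  else if j == i3 then p%:Z ^+ m3 * z x3 else 0.
have xi1 : x i1 = p%:Z ^+ m * z x1 by rewrite /x eqxx.
have xi2 : x i2 = p%:Z ^+ m * z x2 by rewrite /x eq_sym (negbTE i12) eqxx.
have xi3 : x i3 = p%:Z ^+ m3 * z x3.
  by rewrite /x eq_sym (negbTE i13) eq_sym (negbTE i23) eqxx.
have sq i l u : (r i + 2 * l)%N = e ->
    b i * p%:Z ^+ r i * (p%:Z ^+ l * u) ^+ 2 = p%:Z ^+ e * (b i * u ^+ 2).
  by move=> <-; rewrite exprMn -exprM [(l * 2)%N]mulnC exprD; ring.
have sum_x : (p%:Z ^+ e.+1 %| \sum_j b j * p%:Z ^+ r j * x j ^+ 2 - p%:Z ^+ e * t)%Z.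
  rewrite (bigD1 i1) // (bigD1 i2) 1?eq_sym //= (bigD1 i3) /=; last first.
    by rewrite ![i3 == _]eq_sym i13.
  rewrite big1 ?addr0; last first.
    move=> j /andP[/andP[j1 j2] j3].
    by rewrite /x (negbTE j1) (negbTE j2) (negbTE j3) expr0n mulr0.
  rewrite xi1 xi2 xi3 (sq i1 m) // (sq i2 m) //.
  (* If [x3 = 0] both sides vanish, so [r i3] and [e] need not match. *)
  have -> : b i3 * p%:Z ^+ r i3 * (p%:Z ^+ m3 * z x3) ^+ 2 = p%:Z ^+ e * (b i3 * z x3 ^+ 2).
    by case: r3 => [->|/sq //]; rewrite /z /= !mulr0.
  rewrite -!mulrDr -mulrBr [_ ^+ e.+1]exprSr dvdz_mul2l; last first.
    by rewrite expf_neq0 // -lt0n prime_gt0.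
  by rewrite (dvdz_Fp _ hp) rmorphB !rmorphD !(rmorphXn, rmorphM) /= /z !intr_Fp addrA hx subrr.
have zP u : u != 0 -> ~~ (p %| z u)%Z by move=> u0; rewrite (dvdz_Fp _ hp) /z intr_Fp.
have di i l : (r i + 2 * l)%N = e -> b i * p%:Z ^+ r i * p%:Z ^+ (2 * l) = b i * p%:Z ^+ e.
  by move=> <-; rewrite exprD mulrA.
case/orP: x12 => xn0.
  exact: (card_quadric_ge hp op ek (di _ _ r1) xi1 (pb _) (zP _ xn0)).
exact: (card_quadric_ge hp op ek (di _ _ r2) xi2 (pb _) (zP _ xn0)).
Qed.

(** [e] is the valuation of [h] capped at [s]; the cap also covers [h = 0]. *)
Lemma split_ppower (p : nat) (h : int) (s : nat) :
  exists e t, [/\ (e <= s)%N, h = p%:Z ^+ e * t & e = s \/ ~~ (p %| t)%Z].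
Proof.
elim: s => [|s [e [t [es ht]]]]; first by exists 0%N, h; rewrite expr0 mul1r; split; [| |left].
case=> [e_s|pt]; last by exists e, t; split; [exact: ltnW| |right].
have [/dvdzP[u hu]|pt] := boolP (p %| t)%Z; last by exists e, t; split; [exact: ltnW| |right].
by exists s.+1, u; split; [| |left] => //; rewrite ht hu e_s exprSr -mulrA [_ * u]mulrC.
Qed.

(* In the third case [h = p ^ e * t] with [e <= r_5]. The two coordinates of
   exponent 0 ([e] even) or 1 ([e] odd), scaled by [p ^ e./2], represent [h]
   modulo [p ^ e.+1], with the help of the fifth coordinate when [e = r_5]. *)
Lemma card_local_quadric_ge (p n k : nat) (b : 'I_n.+1 -> int) (r : 'I_n.+1 -> nat)
    (h : int) (i := fun j => inord j : 'I_n.+1) (u := (b (i 0) * b (i 1))%:~R : 'F_p) :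
  prime p -> odd p -> (5 <= n)%N -> (r (i 4) <= k)%N ->
  (forall j, ~~ (p %| b j)%Z) -> r (i 0) = 0%N -> r (i 1) = 0%N ->
  [\/ r (i 2) = 0%N,
      (p %% 4 = 1)%N /\ legendre u = 1 \/ (p %% 4 = 3)%N /\ legendre u = -1 |
      r (i 2) = 1%N /\ r (i 3) = 1%N] ->
  ((p ^ (k - r (i 4))) ^ n <=
    #|[set y : 'rV['Z_(p ^ k.+1)]_n.+1 |
        (\sum_j (b j * p%:Z ^+ r j)%:~R * y 0 j ^+ 2 == h%:~R)%R]|)%N.
Proof.
move=> hp op n5 rk pb r0 r1 H.
have b0 j : (b j)%:~R != 0 :> 'F_p by rewrite -dvdz_Fp.
have neq j l : (j < 6)%N -> (l < 6)%N -> (i j == i l) = (j == l).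
  by move=> j6 l6; rewrite -val_eqE /= !inordK //; lia.
have lee e c : (e <= r (i 4))%N -> ((p ^ (k - e)) ^ n <= c)%N ->
    ((p ^ (k - r (i 4))) ^ n <= c)%N.
  move=> ler; apply: leq_trans; rewrite leq_exp2r; last by rewrite (leq_trans _ n5).
  by rewrite leq_pexp2l ?prime_gt0 // leq_sub2l.
case: H => [r2|hu|[r2 r3]].
- apply: (lee 0) => //.
  have [x1 [x2 [x3 [e x12]]]] := Fp_ternary_form_surj h%:~R hp op (b0 (i 0)) (b0 (i 1)) (b0 (i 2)).
  rewrite -[h]mul1r -(expr0 p%:Z).
  apply: (@card_diag_quadric_ge p n k 0 0 0 (i 0) (i 1) (i 2) b r h x1 x2 x3) => //.
  + by rewrite /= !inE !neq.
  + by rewrite r0.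
  + by rewrite r1.
  + by right; rewrite r2.
- apply: (lee 0) => //.
  have [x1 [x2 [e x12]]] : exists x1 x2 : 'F_p,
      (b (i 0))%:~R * x1 ^+ 2 + (b (i 1))%:~R * x2 ^+ 2 = h%:~R /\ (x1 != 0) || (x2 != 0).
    have [h0|h0] := eqVneq (h%:~R : 'F_p) 0.
      (* For [p] dividing [h], the isotropic vector [(y, b_0)] with [y^2 = - b_0 b_1] is a
         nontrivial zero. *)
      have [y yu] := Fp_neg_sqr hp hu.
      exists y, (b (i 0))%:~R; split; last by rewrite b0 orbT.
      by rewrite h0 yu /u rmorphM /=; ring.
    have [x1 [x2 e]] := Fp_binary_form_surj h%:~R hp op (b0 (i 0)) (b0 (i 1)).
    exists x1, x2; split => //; apply: contraNT h0; rewrite negb_or !negbK.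
    by move=> /andP[/eqP x10 /eqP x20]; rewrite -e x10 x20 expr0n !mulr0 addr0.
  rewrite -[h]mul1r -(expr0 p%:Z).
  (* [i 2] merely fills the third slot: its coordinate is 0. *)
  apply: (@card_diag_quadric_ge p n k 0 0 0 (i 0) (i 1) (i 2) b r h x1 x2 0) => //.
  + by rewrite /= !inE !neq.
  + by rewrite r0.
  + by rewrite r1.
  + by left.
  + by rewrite e expr0n mulr0 addr0.
- have [e [t [es -> et]]] := split_ppower p h (r (i 4)).
  apply: (lee e) => //.
  pose i1 := if odd e then i 2 else i 0; pose i2 := if odd e then i 3 else i 1.
  have [x1 [x2 [x3 [ex x12 x30]]]] : exists x1 x2 x3 : 'F_p,
      [/\ (b i1)%:~R * x1 ^+ 2 + (b i2)%:~R * x2 ^+ 2 + (b (i 4))%:~R * x3 ^+ 2 = t%:~R,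
       (x1 != 0) || (x2 != 0) & x3 = 0 \/ (r (i 4) + 2 * 0)%N = e].
    (* At the cap [e = r_5], [p] may divide [t], and the pair alone may represent it only trivially;
       the unscaled fifth coordinate then has the right exponent. Below the cap [t] is nonzero
       modulo [p] and the pair suffices. *)
    case: et => [er|].
      have [x1 [x2 [x3 [ex x12]]]] := Fp_ternary_form_surj t%:~R hp op (b0 i1) (b0 i2) (b0 (i 4)).
      by exists x1, x2, x3; split => //; right; rewrite addn0.
    rewrite (dvdz_Fp _ hp) => t0.
    have [x1 [x2 ex]] := Fp_binary_form_surj t%:~R hp op (b0 i1) (b0 i2).
    exists x1, x2, 0; rewrite expr0n mulr0 addr0; split => //; last by left.
    apply: contraNT t0; rewrite negb_or !negbK.
    by move=> /andP[/eqP x10 /eqP x20]; rewrite -ex x10 x20 expr0n !mulr0 addr0.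
  apply: (@card_diag_quadric_ge p n k e e./2 0 i1 i2 (i 4) b r t x1 x2 x3) => //.
  + exact: leq_trans rk.
  + by rewrite /i1 /i2; case: (odd e); rewrite /= !inE !neq.
  + by rewrite mul2n -[RHS]odd_double_half /i1; case: (odd e); rewrite ?r2 ?r0.
  + by rewrite mul2n -[RHS]odd_double_half /i2; case: (odd e); rewrite ?r3 ?r1.
Qed.

(** * Quadratic exponential sums modulo q *)

(** The character [e^(-2 pi i t)], with the sign and the shape of [e_p], so that [e_p] unfolds to it
    by conversion. *)
Definition turn (R : realType) (t : R) : R[i] :=
  Complex (cos (- (2%:R * pi * t))) (sin (- (2%:R * pi * t))).

Section Turn.
Variable R : realType.
Implicit Types s t : R.

Lemma turnD s t : turn (s + t) = turn s * turn t.
Proof.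
rewrite /turn mulrDr opprD cosD sinD; simpc.
by congr Complex; rewrite addrC.
Qed.

Lemma turn0 : turn (0 : R) = 1.
Proof. by rewrite /turn mulr0 oppr0 cos0 sin0. Qed.

Lemma turn_norm t : `|turn t| = 1.
Proof. by rewrite normc_def /= cos2Dsin2 sqrtr1. Qed.

Lemma turn1 : turn (1 : R) = 1.
Proof.
by rewrite /turn mulr1 cosN sinN mulr_natl cos2pi sin2pi oppr0.
Qed.

Lemma turn_nat (n : nat) : turn (n%:R : R) = 1.
Proof. by elim: n => [|n IH]; rewrite ?turn0 // -natr1 turnD IH turn1 mulr1. Qed.

Lemma turnN t : turn (- t) = (turn t)^-1.
Proof.
have t0 : turn t != 0 by rewrite -normr_eq0 turn_norm oner_eq0.
by apply: (mulIf t0); rewrite mulVf // -turnD addNr turn0.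
Qed.

Lemma turn_int (m : int) : turn (m%:~R : R) = 1.
Proof. by case: m => n; rewrite ?NegzE ?mulrNz ?turnN turn_nat ?invr1. Qed.

Lemma turn_conj t : (turn t)^* = turn (- t).
Proof. by rewrite turnN invC_norm turn_norm expr1n invr1 mul1r. Qed.

(** The real part [cos (2 pi t) = 1 - 2 sin (pi t) ^ 2] is already less than 1. *)
Lemma turn_neq1 t : 0 < t < 1 -> turn t != 1.
Proof.
move=> /andP[t0 t1]; apply/eqP => /(congr1 (@complex.Re R)) /=.
have -> : - (2%:R * pi * t) = (- (pi * t)) *+ 2 by rewrite -mulr_natl; ring.
rewrite cos_mulr2n cosN cos2sin2 => /eqP.
have : 0 < sin (pi * t).
  by apply: sin_gt0_pi; rewrite mulr_gt0 ?pi_gt0 //= -[ltRHS]mulr1 ltr_pM2l ?pi_gt0.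
by move=> s0; nra.
Qed.

End Turn.

Definition psi (R : realType) (q : nat) (x : 'Z_q) : R[i] := turn ((x : nat)%:R / q%:R : R).

Section AdditiveCharacter.
Variables (R : realType) (q : nat).
Hypothesis q1 : (1 < q)%N.
Local Notation psi := (psi R).

(** Any integer representative may be used, as [turn] has period 1; additivity and conjugation of
    [psi] are read off from integers. *)
Lemma psi_int (m : int) : psi (m%:~R : 'Z_q) = turn (m%:~R / q%:R : R).
Proof.
have q0 : (q%:R : R) != 0 by rewrite pnatr_eq0 -lt0n ltnW.
set x := m%:~R : 'Z_q.
have : (q %| (x : nat)%:Z - m)%Z.
  by rewrite -Zp_intr_eq0 // rmorphB /= -pmulrn natr_Zp subrr.
case/dvdzP => c hc; rewrite /psi -/x.
have -> : (x : nat)%:R / q%:R = m%:~R / q%:R + c%:~R :> R.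
  apply: (mulIf q0); rewrite mulrDl !divfK //.
  have -> : (x : nat)%:R = ((x : nat)%:Z)%:~R :> R by [].
  by rewrite -[(x : nat)%:Z](subrK m) hc rmorphD rmorphM /= addrC.
by rewrite turnD turn_int mulr1.
Qed.

Lemma Zp_natE (x : 'Z_q) : x = (x : nat)%:Z%:~R.
Proof. by rewrite -pmulrn natr_Zp. Qed.

Lemma psiD (x y : 'Z_q) : psi (x + y) = psi x * psi y.
Proof. by rewrite [x]Zp_natE [y]Zp_natE -rmorphD /= !psi_int rmorphD mulrDl turnD. Qed.

Lemma psi0 : psi (0 : 'Z_q) = 1.
Proof. by rewrite /psi mul0r turn0. Qed.

Lemma psi_norm (x : 'Z_q) : `|psi x| = 1.
Proof. exact: turn_norm. Qed.

Lemma psi_conj (x : 'Z_q) : (psi x)^* = psi (- x).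
Proof. by rewrite [x]Zp_natE -rmorphN /= !psi_int turn_conj rmorphN mulNr. Qed.

Lemma psi_sum (I : Type) (r : seq I) (P : pred I) (F : I -> 'Z_q) :
  psi (\sum_(i <- r | P i) F i) = \prod_(i <- r | P i) psi (F i).
Proof. exact: (big_morph _ psiD psi0). Qed.

Lemma psi_orthogonality (t : 'Z_q) : \sum_s psi (s * t) = q%:R * (t == 0)%:R.
Proof.
have [->|t0] := eqVneq t 0.
  under eq_bigr do rewrite mulr0 psi0.
  by rewrite sumr_const card_ord Zp_cast // mulr1.
rewrite mulr0; have pt : psi t - 1 != 0.
  rewrite subr_eq0; apply: turn_neq1.
  have qR : 0 < q%:R :> R by rewrite ltr0n ltnW.
  have tq : (t < q)%N by case: (t) => m /=; rewrite Zp_cast.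
  apply/andP; split; first by rewrite divr_gt0 // ltr0n lt0n.
  by rewrite ltr_pdivrMr // mul1r ltr_nat.
(* The shift of [s] by 1 permutes the terms and multiplies the sum by [psi t], which is not 1. *)
apply: (mulfI pt); rewrite mulr0 mulrBl mul1r mulr_sumr; apply/eqP; rewrite subr_eq0.
rewrite [X in _ == X](reindex_inj (addrI 1)) /=; apply/eqP/eq_bigr => s _.
by rewrite mulrDl mul1r psiD.
Qed.

(* Expand the square and substitute [x = y + d]: the sum over [y] is then linear. *)
Lemma gauss_sum_norm (a : 'Z_q) :
  `|\sum_x psi (a * x ^+ 2)| ^+ 2 <= q%:R * #|[set d : 'Z_q | 2%:R * a * d == 0]|%:R.
Proof.
rewrite -[leLHS]ger0_norm ?exprn_ge0 // normCK rmorph_sum mulr_suml.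
have -> : \sum_x psi (a * x ^+ 2) * (\sum_y (psi (a * y ^+ 2))^*) =
    \sum_d psi (a * d ^+ 2) * (q%:R * (2%:R * a * d == 0)%:R).
  under eq_bigr do rewrite mulr_sumr.
  rewrite exchange_big /=.
  under eq_bigr => y _ do rewrite (reindex_inj (addrI y)) /=.
  rewrite exchange_big /=; apply: eq_bigr => d _.
  rewrite -psi_orthogonality mulr_sumr; apply: eq_bigr => y _.
  by rewrite psi_conj -!psiD; congr psi; ring.
apply: le_trans (ler_norm_sum _ _ _) _.
rewrite -sum1_card natr_sum mulr_sumr big_mkcond /= [X in _ <= X]big_mkcond /=.
apply: ler_sum => d _; rewrite inE normrM psi_norm mul1r normrM !normr_nat.
by case: ifP => _; rewrite ?mulr1 ?mulr0.
Qed.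

End AdditiveCharacter.

(** With [q = q' * g], the cofactor [a / g] is prime to [q'], so annihilated elements are multiples
    of [q']; division by [q'] sends them injectively below [g]. *)
Lemma card_Zp_annihilator (q a : nat) : (1 < q)%N ->
  (#|[set d : 'Z_q | (a%:R * d == 0)%R]| <= gcdn a q)%N.
Proof.
move=> q1; set g := gcdn a q; set A := [set d | _].
have g0 : (0 < g)%N by rewrite gcdn_gt0 (ltnW q1) orbT.
pose q' := (q %/ g)%N.
have qE : (q' * g = q)%N by rewrite divnK // dvdn_gcdr.
have q'0 : (0 < q')%N by case: (q') qE q1 => // <-.
have dq (d : 'Z_q) : (d < q)%N by case: d => m /=; rewrite Zp_cast.
have dv d : d \in A -> (q' %| d)%N.
  rewrite inE (_ : a%:R * d = ((a * d)%N%:Z)%:~R); last first.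
    by rewrite -pmulrn natrM natr_Zp.
  rewrite Zp_intr_eq0 // dvdzE /= => h.
  rewrite -(Gauss_dvdr _ (_ : coprime q' (a %/ g))); last first.
    rewrite /coprime -(eqn_pmul2r g0) muln_gcdl !divnK ?dvdn_gcdr ?dvdn_gcdl //.
    by rewrite gcdnC mul1n.
  by rewrite -(dvdn_pmul2r g0) qE mulnAC divnK ?dvdn_gcdl.
pose F (d : 'Z_q) : 'I_g.-1.+1 := inord (d %/ q')%N.
have dlt (d : 'Z_q) : (d %/ q' < g)%N by rewrite ltn_divLR // mulnC qE.
have Finj : {in A &, injective F}.
  move=> d d' /dv hd /dv hd' /(congr1 (@nat_of_ord _)).
  rewrite !inordK ?prednK // => e; apply: val_inj => /=.
  by rewrite -(divnK hd) -(divnK hd') e.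
rewrite -(card_in_imset Finj) -[X in (_ <= X)%N](prednK g0).
by rewrite (leq_trans (max_card _)) // card_ord.
Qed.

Definition quadric_char_sum (R : realType) (n q : nat) (a : 'I_n -> nat) (h s : 'Z_q) : R[i] :=
  \sum_(x : 'rV['Z_q]_n) psi R (s * (\sum_j (a j)%:R * x 0 j ^+ 2 - h)).

Section QuadricCharSum.
Variables (R : realType) (n q : nat) (a : 'I_n -> nat) (h : 'Z_q).
Hypothesis q1 : (1 < q)%N.
Local Notation S := (quadric_char_sum R a h).

Lemma quadric_char_sum_prod s :
  S s = psi R (- (s * h)) * \prod_j \sum_x psi R (s * (a j)%:R * x ^+ 2).
Proof.
rewrite bigA_distr_bigA /= mulr_sumr /quadric_char_sum.
rewrite (reindex (fun f : {ffun 'I_n -> 'Z_q} => \row_j f j)) /=; last first.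
  exists (fun x : 'rV['Z_q]_n => [ffun j => x 0 j]) => x _.
    by apply/ffunP => j; rewrite ffunE mxE.
  by apply/rowP => j; rewrite mxE ffunE.
apply: eq_bigr => f _; rewrite -psi_sum // -psiD //; congr psi.
rewrite mulrBr mulr_sumr addrC; congr (_ + _); apply: eq_bigr => j _.
by rewrite mxE mulrA.
Qed.

(** The sum splits into one Gauss sum per coordinate, and the units [s] and 2 do not change the
    annihilator of [a j]. *)
Lemma quadric_char_sum_norm s : s \is a GRing.unit -> (2%:R : 'Z_q) \is a GRing.unit ->
  `|S s| ^+ 2 <= (q ^ n * \prod_j gcdn (a j) q)%N%:R.
Proof.
move=> us u2; rewrite quadric_char_sum_prod normrM psi_norm mul1r normr_prod -prodrXl.
have -> : (q ^ n)%N = (\prod_(j < n) q)%N by rewrite prod_nat_const card_ord.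
rewrite -big_split natr_prod /=; apply: ler_prod => j _.
rewrite exprn_ge0 //= natrM (le_trans (gauss_sum_norm R q1 _)) //.
rewrite ler_wpM2l // ler_nat (leq_trans _ (card_Zp_annihilator (a j) q1)) //.
apply/subset_leq_card/fintype.subsetP => d; rewrite !inE.
by rewrite -!mulrA (mulrI_eq0 _ (mulrI u2)) (mulrI_eq0 _ (mulrI us)).
Qed.

Lemma quadric_char_sum_total :
  \sum_s S s = (q * #|[set x : 'rV['Z_q]_n | (\sum_j (a j)%:R * x 0 j ^+ 2 == h)%R]|)%N%:R.
Proof.
rewrite exchange_big /=; under eq_bigr do rewrite psi_orthogonality // subr_eq0.
rewrite -mulr_sumr natrM -sum1_card natr_sum; congr (_ * _).
by rewrite [RHS]big_mkcond; apply: eq_bigr => x _; rewrite inE; case: ifP.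
Qed.

End QuadricCharSum.

(** * p-adic integers and numbers *)

Section PadicFacts.
Variables (p : nat) (hp : prime p).
Local Notation Zp := (padic_int hp).
Local Notation Qp := (padic hp).
Local Notation io := (@Zp_to_Qp p hp).
Implicit Types x y z : Zp.

Lemma padic_resD x y k :
  padic_res (x + y) k = ((padic_res x k + padic_res y k) %% (p ^ k)%N%:Z)%Z.
Proof. by []. Qed.

Lemma padic_resM x y k :
  padic_res (x * y) k = ((padic_res x k * padic_res y k) %% (p ^ k)%N%:Z)%Z.
Proof. by []. Qed.

Lemma padic_resN x k : padic_res (- x) k = ((- padic_res x k) %% (p ^ k)%N%:Z)%Z.
Proof. by []. Qed.

Lemma padic_res_int (m : int) k : padic_res (m%:~R : Zp) k = (m %% (p ^ k)%N%:Z)%Z.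
Proof.
have nat_case (n : nat) : padic_res (n%:R : Zp) k = (n%:Z %% (p ^ k)%N%:Z)%Z.
  elim: n => [|n IH]; first by rewrite -[0%:R]/(Zp_of_int hp 0).
  by rewrite -natr1 padic_resD IH -[1]/(Zp_of_int hp 1) resE modzDm -addn1.
case: m => n; first exact: nat_case.
by rewrite NegzE mulrNz padic_resN [padic_res _ _]nat_case modzNm.
Qed.

Lemma intr_Zp_inj : injective (intr : int -> Zp).
Proof.
(* The level [d = |m - n|] works because [p^d > d], so [p^d] divides [d] only for [d = 0]. *)
move=> m n /(congr1 (fun x => padic_res x `|m - n|)); rewrite !padic_res_int.
move=> /eqP; rewrite eqz_mod_dvd dvdzE /= => d; apply/eqP; rewrite -subr_eq0 -absz_eq0.
by apply: contraLR d; rewrite -lt0n => d0; rewrite gtnNdvd // ltn_expl // prime_gt1.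
Qed.

Lemma padic_divp x k : (p ^ k %| `|padic_res x k|)%N -> exists z, x = p%:R ^+ k * z.
Proof.
move=> xk; have dv j : ((p ^ k)%N%:Z %| padic_res x (k + j))%Z.
  apply/dvdz_mod0P; rewrite (res_mod_le x (leq_addr j k)); exact/dvdz_mod0P.
(* Division by [p^k] costs [k] digits: the quotient modulo [p^j] is read off from [x] modulo
   [p^(k+j)]. *)
pose f j := (padic_res x (k + j) %/ (p ^ k)%N%:Z)%Z.
have fE j : padic_res x (k + j) = f j * (p ^ k)%N%:Z by rewrite divzK.
have q0 : (p ^ k)%N%:Z != 0 by rewrite eqz_nat expn_eq0 negb_and -lt0n prime_gt0.
have cf : coherent p f.
  move=> j; apply/eqP; rewrite eqz_mod_dvd -(dvdz_mul2r q0) mulrBl -!fE -PoszM.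
  rewrite -expnD [(j + k)%N]addnC -eqz_mod_dvd; apply/eqP/esym.
  by rewrite addnS; exact: res_mod_le.
exists (of_coherent hp cf); apply: eq_Zp => j.
rewrite -natrX padic_resM modz_mod pmulrn padic_res_int resE modzMml modzMmr.
by rewrite mulrC -fE (res_mod_le x (leq_addl k j)).
Qed.

Lemma padic_unit_res x k : x \is a GRing.unit -> ~~ (p %| padic_res x k.+1)%Z.
Proof.
move=> ux; have := congr1 (fun x => padic_res x k.+1) (mulVr ux).
rewrite -[1]/(Zp_of_int hp 1) padic_resM resE => /eqP; rewrite eqz_mod_dvd => d1.
apply/negP => px; have : (p%:Z %| 1)%Z.
  have := rpredB (dvdz_mull (padic_res x^-1 k.+1) px) (_ : (p%:Z %| _)%Z).
  move=> /(_ (padic_res x^-1 k.+1 * padic_res x k.+1 - 1)); rewrite opprB addrCA subrr addr0.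
  by apply; apply: dvdz_trans d1; rewrite dvdzE /= expnS dvdn_mulr.
by rewrite dvdzE /= dvdn1 => /eqP p1; move: hp; rewrite p1.
Qed.

Lemma padic_unit x : ~~ (p %| padic_res x 1)%Z -> x \is a GRing.unit.
Proof.
move=> px; have res1 k : (padic_res x k.+1 == padic_res x 1 %[mod p])%Z.
  by have := res_mod_le x (isT : 1 <= k.+1)%N; rewrite expn1 => /eqP.
have cop k : coprimez (padic_res x k) (p ^ k)%N%:Z.
  case: k => [|k]; first by rewrite expn0 coprimezE /= coprimen1.
  rewrite coprimezE /= coprime_sym coprimeXl // prime_coprime //.
  by apply: contra px => xk; apply/dvdz_mod0P; rewrite -(eqP (res1 k)); apply/dvdz_mod0P.
have /choice[f hf] k : exists v : int, ((p ^ k)%N%:Z %| v * padic_res x k - 1)%Z.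
  have /coprimezP[[u v] /= uv] := cop k; exists u; apply/dvdzP; exists (- v).
  by rewrite -uv; ring.
(* The inverses were chosen independently at each level; they cohere because an inverse modulo [p^k]
   is unique. *)
have cf : coherent p f.
  move=> k; apply/eqP; rewrite eqz_mod_dvd -(Gauss_dvdzl _ (_ : coprimez _ (padic_res x k))).
    2: by rewrite coprimez_sym.
  have -> : (f k - f k.+1) * padic_res x k = (f k * padic_res x k - 1) -
      (f k.+1 * padic_res x k.+1 - 1) - f k.+1 * (padic_res x k - padic_res x k.+1) by ring.
  apply: rpredB; first apply: rpredB => //.
    by apply: dvdz_trans (hf k.+1); rewrite dvdzE /= dvdn_exp2l.
  by rewrite dvdz_mull // -eqz_mod_dvd -(res_mod_le x (leqnSn k)).
apply/unitrPr; exists (of_coherent hp cf); apply: eq_Zp => k.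
rewrite padic_resM resE modz_mod modzMmr mulrC.
by rewrite -[1]/(Zp_of_int hp 1) resE modz_mod; apply/eqP; rewrite eqz_mod_dvd.
Qed.

Lemma padic_nat_unit (n : nat) : ~~ (p %| n)%N -> (n%:R : Zp) \is a GRing.unit.
Proof.
move=> pn; apply: padic_unit; rewrite pmulrn padic_res_int expn1.
by apply: contra pn => /dvdz_mod0P; rewrite modz_mod => /dvdz_mod0P.
Qed.

Lemma Zp_to_Qp_inj : injective io.
Proof. by move=> x y /eqP; rewrite tofrac_eq => /eqP. Qed.

Lemma intr_Qp (m : int) : m%:~R = io m%:~R.
Proof. by rewrite rmorph_int. Qed.

Lemma intr_Qp_eq0 (m : int) : (m%:~R == 0 :> Qp) = (m == 0).
Proof.
rewrite intr_Qp -(rmorph0 io) (inj_eq Zp_to_Qp_inj) -[0 in LHS](mulr0z 1).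
by rewrite (inj_eq intr_Zp_inj).
Qed.

Lemma natr_Qp_eq0 (m : nat) : (m%:R == 0 :> Qp) = (m == 0)%N.
Proof. by rewrite pmulrn intr_Qp_eq0. Qed.

(** [ratr] is computed from the reduced fraction; cross-multiplication, carried through the
    injection of the integers into Q_p, evaluates it on any fraction. *)
Lemma ratr_Qp (x : rat) (m n : int) : n != 0 -> x = m%:~R / n%:~R -> ratr x = m%:~R / n%:~R :> Qp.
Proof.
move=> n0 xE; have n0' : n%:~R != 0 :> Qp by rewrite intr_Qp_eq0.
have d0 : (denq x)%:~R != 0 :> Qp by rewrite intr_Qp_eq0 denq_neq0.
rewrite /ratr; apply/eqP; rewrite eqr_div // -!rmorphM /= -subr_eq0 -rmorphB intr_Qp_eq0 subr_eq0.
rewrite -(eqr_int rat) !rmorphM /= -eqr_div ?intr_eq0 // ?denq_neq0 //.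
by rewrite divq_num_den xE.
Qed.

Lemma ratr_nat_Qp (m : nat) : ratr m%:R = m%:R :> Qp.
Proof. by rewrite (@ratr_Qp _ m 1) // ?divr1 // pmulrn. Qed.

Lemma ratr_padic_int (m : int) (n : nat) : ~~ (p %| n)%N ->
  exists z, ratr (m%:~R / n%:R) = io z.
Proof.
move=> pn; exists (m%:~R * n%:R^-1).
have n0 : n != 0%N by apply: contraNneq pn => ->; rewrite dvdn0.
rewrite (@ratr_Qp _ m n) // rmorphM rmorph_int; congr (_ * _).
have n0' : (n%:R : Qp) != 0 by rewrite natr_Qp_eq0.
apply: (mulIf n0'); rewrite -[n%:~R]/(n%:R) mulVf // -(rmorph_nat io) -rmorphM.
by rewrite mulVr ?rmorph1 // padic_nat_unit.
Qed.

(** Induction on a level at which the residue of [x] is nonzero: division by [p] lowers it by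
    one. *)
Lemma padic_ppow_unit x : x != 0 -> exists k u, u \is a GRing.unit /\ x = p%:R ^+ k * u.
Proof.
move=> /Zp_neq0[k]; elim: k x => [|k IH] x; first by rewrite expn0 dvdzE dvd1n.
have [px|px _] := boolP (p %| padic_res x 1)%Z; last first.
  by exists 0%N, x; rewrite expr0 mul1r; split => //; apply: padic_unit.
have [z xE] : exists z, x = p%:R ^+ 1 * z by apply: padic_divp; rewrite expn1.
move=> xk; have /IH[l [u [uu zE]]] : ~~ ((p ^ k)%N%:Z %| padic_res z k)%Z.
  apply: contra xk => zk; rewrite xE expr1 padic_resM pmulrn padic_res_int.
  apply/dvdz_mod0P; rewrite modz_mod modzMml; apply/dvdz_mod0P.
  rewrite expnS PoszM dvdz_mul ?dvdzz //; apply/dvdz_mod0P.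
  by rewrite (res_mod_le z (leqnSn k)); apply/dvdz_mod0P.
by exists l.+1, u; split => //; rewrite xE zE expr1 exprS mulrA.
Qed.

Lemma padic_fraction (x : Qp) : exists w k, x = io w / p%:R ^+ k.
Proof.
have [a [c [c0 ->]]] : exists a c : Zp, c != 0 /\ x = io a / io c.
  elim/quotW: x => y; exists (frac y).1, (frac y).2.
  have y0 := denom_ratioP y; split; first exact: y0.
  apply: (canRL (mulfK _)); first by rewrite /Zp_to_Qp tofrac_eq0.
  rewrite /Zp_to_Qp; unlock FracField.tofrac.
  rewrite -[LHS]FracField.pi_mul.
  apply/eqmodP; rewrite /= FracField.equivfE /FracField.mulf /=.
  by rewrite !numden_Ratio ?(oner_neq0, mul1r, mulr1, y0) // mulrC.
have [k [u [uu ->]]] := padic_ppow_unit c0.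
exists (a / u), k; rewrite !rmorphM rmorphV // rmorphXn rmorph_nat invfM.
by rewrite -mulrA [_^-1 * _]mulrC mulrA.
Qed.

End PadicFacts.

(** This identity and the next compare two representatives of one class modulo Z_p in [e_p_div], the
    first over Q_p and the second over the reals. *)
Lemma sub_fractions (F : fieldType) (w x y P Q : F) : P != 0 -> Q != 0 ->
  x * P - y * Q = P * Q * (w - y / P - (w - x / Q)).
Proof. by move=> hP hQ; field; rewrite hP hQ. Qed.

Lemma eq_fractions (F : fieldType) (x y c P Q : F) : P != 0 -> Q != 0 ->
  x * P - y * Q = c * (P * Q) -> x / Q = y / P + c.
Proof.
move=> hP hQ h; have -> : x / Q = (x * P - y * Q) / (P * Q) + y / P.
  by field; rewrite hP hQ.
by rewrite h mulfK ?mulf_neq0 // addrC.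
Qed.

(** * Reduction modulo prime powers and the standard character of Q_p *)

Section Reduction.
Variables (p : nat) (hp : prime p).
Local Notation Zp := (padic_int hp).
Local Notation Qp := (padic hp).
Local Notation io := (@Zp_to_Qp p hp).
Implicit Types x y z : Zp.

Lemma ppow_gt1 k : (1 < p ^ k.+1)%N.
Proof. by rewrite -(exp1n k.+1) ltn_exp2r // prime_gt1. Qed.

Lemma Zp_intr_modz (q : nat) (m : int) : (1 < q)%N -> (m %% q%:Z)%Z%:~R = m%:~R :> 'Z_q.
Proof.
move=> q1; apply/eqP; rewrite -subr_eq0 -rmorphB Zp_intr_eq0 //.
by rewrite [X in _ - X](divz_eq m q) opprD addrCA subrr addr0 dvdzE abszN -dvdzE dvdz_mull.
Qed.

(** The index is shifted by one because ['Z_q] is Z/q only for [q > 1]. *)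
Definition padic_red k x : 'Z_(p ^ k.+1) := (padic_res x k.+1)%:~R.

Lemma padic_red_is_additive k : zmod_morphism (padic_red k).
Proof.
move=> x y; rewrite /padic_red padic_resD padic_resN Zp_intr_modz ?ppow_gt1 //.
by rewrite rmorphD /= Zp_intr_modz ?ppow_gt1 // rmorphN.
Qed.

Lemma padic_red_is_multiplicative k : monoid_morphism (padic_red k).
Proof.
split=> [|x y]; rewrite /padic_red.
  have -> : padic_res (1 : Zp) k.+1 = (1 %% (p ^ k.+1)%N%:Z)%Z by [].
  by rewrite Zp_intr_modz ?ppow_gt1.
by rewrite padic_resM Zp_intr_modz ?ppow_gt1 // rmorphM.
Qed.

HB.instance Definition _ k :=
  GRing.isZmodMorphism.Build Zp ('Z_(p ^ k.+1)) (padic_red k) (padic_red_is_additive k).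
HB.instance Definition _ k :=
  GRing.isMonoidMorphism.Build Zp ('Z_(p ^ k.+1)) (padic_red k) (padic_red_is_multiplicative k).

Lemma padic_redK k (y : 'Z_(p ^ k.+1)) : padic_red k (y : nat)%:R = y.
Proof. by rewrite rmorph_nat natr_Zp. Qed.

Lemma padic_red_eq0 k x : padic_red k x = 0 -> exists z, x = p%:R ^+ k.+1 * z.
Proof.
by move=> /eqP; rewrite Zp_intr_eq0 ?ppow_gt1 // dvdzE => /padic_divp.
Qed.

Lemma padic_red_mulp k z : padic_red k (p%:R ^+ k.+1 * z) = 0.
Proof.
rewrite rmorphM -natrX rmorph_nat.
by rewrite (_ : _%:R = 0) ?mul0r //; apply/eqP; rewrite -val_eqE /= val_Zp_nat ?ppow_gt1 // modnn.
Qed.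

Lemma dvdz_padic (m : int) k z : m%:~R = p%:R ^+ k * z -> ((p ^ k)%N%:Z %| m)%Z.
Proof.
move=> /(congr1 (fun x => padic_res x k)); rewrite -natrX padic_resM padic_res_int.
by rewrite pmulrn padic_res_int modzMml modzMr => /dvdz_mod0P.
Qed.

Lemma ppow_Qp_neq0 k : p%:R ^+ k != 0 :> Qp.
Proof. by rewrite expf_neq0 // natr_Qp_eq0 -lt0n prime_gt0. Qed.

(** The set from which [xget] picks is the same for both arguments, hence so is the element
    picked. *)
Lemma e_p_periodic (R : realType) (z : Qp) w : e_p R (z + io w) = e_p R z.
Proof.
rewrite /e_p; have -> // : [set y | Zinvp p y /\ Qp_integers hp (z + io w - ratr y)]%classic =
  [set y | Zinvp p y /\ Qp_integers hp (z - ratr y)]%classic.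
apply/funext => y; apply/propext; split=> -[zy [u _ hu]]; split => //.
  by exists (u - w) => //; rewrite rmorphB /= hu; ring.
by exists (u + w) => //; rewrite rmorphD /= hu; ring.
Qed.

Lemma e_p_div (R : realType) (w : Zp) k :
  e_p R (io w / p%:R ^+ k.+1) = psi R (padic_red k w).
Proof.
have P0 l := ppow_Qp_neq0 l.
have ratrE (m : int) l : ratr (m%:~R / p%:R ^+ l) = m%:~R / p%:R ^+ l :> Qp.
  have pl0 : (p ^ l)%N%:Z != 0 by rewrite eqz_nat expn_eq0 negb_and -lt0n prime_gt0.
  have plE (F : unitRingType) : (p ^ l)%N%:~R = p%:R ^+ l :> F.
    by rewrite -[LHS]/((p ^ l)%N%:R) natrX.
  by rewrite (@ratr_Qp p hp _ m (p ^ l)%N pl0) plE.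
rewrite /e_p; set A := [set y | _]%classic.
set m0 := padic_res w k.+1.
have A0 : A (m0%:~R / p%:R ^+ k.+1).
  split; first by exists m0, k.+1.
  have [u hu] : exists u, w - m0%:~R = p%:R ^+ k.+1 * u.
    apply: padic_red_eq0; rewrite rmorphB rmorph_int; apply/eqP.
    by rewrite subr_eq0.
  exists u => //; apply: (mulIf (P0 k.+1)); rewrite ratrE mulrBl !divfK //.
  by rewrite mulrC -(rmorph_nat io) -rmorphXn -rmorphM -hu rmorphB rmorph_int.
have [[m [j yE]] [u _ hu]] := xgetPex 0 (ex_intro A _ A0).
set y := xget 0 A in yE hu *; rewrite psi_int ?ppow_gt1 //.
have [_ [u0 _ hu0]] := A0.
rewrite ratrE in hu0; rewrite yE ratrE in hu.
(* The picked [y] and [m0 / p^(k+1)] both differ from the argument by p-adic integers. Their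
   difference lies in Z[1/p] and in Z_p, so it is an integer [c], invisible to [turn]. *)
have /dvdz_padic/dvdzP[c hc] : (m * (p ^ k.+1)%N%:Z - m0 * (p ^ j)%N%:Z)%:~R =
    p%:R ^+ (k.+1 + j) * (u0 - u) :> Zp.
  apply: (@Zp_to_Qp_inj p hp); rewrite rmorph_int rmorphM rmorphXn rmorph_nat /=.
  rewrite [X in _ = _ * X](rmorphB io) /= hu hu0.
  rewrite rmorphB !rmorphM /= -[(p ^ k.+1)%N%:~R]/((p ^ k.+1)%N%:R) -[(p ^ j)%N%:~R]/((p ^ j)%N%:R).
  rewrite !natrX exprD.
  exact: sub_fractions.
have pR l : p%:R ^+ l != 0 :> R by rewrite expf_neq0 // pnatr_eq0 -lt0n prime_gt0.
have -> : (ratr y : R) = m0%:~R / (p ^ k.+1)%N%:R + c%:~R.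
  rewrite yE rmorphM fmorphV rmorphXn /= ratr_nat ratr_int natrX.
  apply: eq_fractions => //.
  have := congr1 (fun x : int => x%:~R : R) hc; rewrite rmorphB !rmorphM /=.
  by rewrite -![(_ ^ _)%N%:~R]/((_ ^ _)%N%:R) !natrX exprD.
by rewrite -[LHS]/(turn _) turnD turn_int mulr1.
Qed.

End Reduction.

(** * The localized lattice in coordinates *)

Section LocalLattice.
Variables (V : vectType rat) (B : V -> V -> rat) (n : nat) (v : n.-tuple V) (a : n.-tuple nat).
Hypothesis v_basis : basis_of fullv v.
Hypothesis gram : forall i j : 'I_n,
  B (tnth v i) (tnth v j) = if i == j then (tnth a i)%:R else 0.
Variables (p : nat) (hp : prime p).
Local Notation Zp := (padic_int hp).
Local Notation Qp := (padic hp).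
Local Notation io := (@Zp_to_Qp p hp).

Lemma map_mx_Zp_to_Qp_inj (m l : nat) : injective (map_mx io : 'M[Zp]_(m, l) -> 'M[Qp]_(m, l)).
Proof.
move=> A A' /matrixP e; apply/matrixP => i j; apply: (@Zp_to_Qp_inj p hp).
by have := e i j; rewrite !mxE.
Qed.

Lemma localize_basis j : localize v hp (tnth v j) = delta_mx 0 j.
Proof.
apply/rowP => l; rewrite !mxE eqxx /= (tnth_nth 0) coord_free ?(basis_free v_basis) //.
by rewrite -val_eqE eq_sym ratr_nat_Qp.
Qed.

Lemma L_pE : L_p v hp = range (fun z : 'rV[Zp]_n => map_mx io z).
Proof.
apply/seteqP; split => [x [z _ <-]|x [z _ <-]].
  exists (\row_j z j) => //; apply/rowP => j; rewrite !mxE summxE (bigD1 j) //= big1 => [|i ij].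
    by rewrite localize_basis !mxE !eqxx mulr1 addr0.
  by rewrite localize_basis !mxE [j == i]eq_sym (negbTE ij) andbF mulr0.
exists (z 0) => //; apply/rowP => j; rewrite !mxE summxE (bigD1 j) //= big1 => [|i ij].
  by rewrite localize_basis !mxE !eqxx mulr1 addr0.
by rewrite localize_basis !mxE [j == i]eq_sym (negbTE ij) andbF mulr0.
Qed.

Lemma gram_pE : gram_p v B hp = diag_mx (\row_j (tnth a j)%:R).
Proof.
apply/matrixP => i j; rewrite !mxE gram; case: eqVneq => [->|_].
  by rewrite ratr_nat_Qp mulr1n.
by rewrite -[0 in LHS]/(0%:R) ratr_nat_Qp mulr0n.
Qed.

Lemma phi_pE (z : 'rV[Zp]_n) :
  phi_p v B (map_mx io z) = io (\sum_j (tnth a j)%:R * z 0 j ^+ 2).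
Proof.
rewrite /phi_p gram_pE mxE rmorph_sum; apply: eq_bigr => j _.
by rewrite mul_mx_diag !mxE rmorphM rmorphXn rmorph_nat /=; ring.
Qed.

Lemma X_pE (c : int) (N : nat) : ~~ (p %| N)%N ->
  X_p v (- (c%:~R / N%:R) *: \sum_(j < n) tnth v j) = L_p v hp.
Proof.
move=> pN; set nu := _ *: _.
have [u hu] := ratr_padic_int hp (- c) pN.
have nuE : localize v hp nu = map_mx io (const_mx u).
  apply/rowP => j; rewrite !mxE -hu /nu; congr ratr.
  rewrite linearZ linear_sum /= (bigD1 j) //= big1 => [|i ij].
    rewrite (tnth_nth 0) coord_free ?(basis_free v_basis) // eqxx addr0 mulr1.
    by rewrite rmorphN mulNr.
  rewrite (tnth_nth 0) coord_free ?(basis_free v_basis) //.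
  by move: ij; rewrite -val_eqE => /negbTE ->.
rewrite /X_p nuE L_pE; apply/seteqP; split => [x [_ [z _ <-] <-]|x [z _ <-]].
  by exists (z + const_mx u) => //; rewrite map_mxD.
by exists (map_mx io (z - const_mx u)); [exists (z - const_mx u)|rewrite -map_mxD subrK].
Qed.

Lemma coset_value_padic (c : int) (N : nat) (h : rat) : odd p -> ~~ (p %| N)%N ->
  (exists m : int, h - \sum_(j < n) (tnth a j)%:R * (c%:~R / N%:R) ^+ 2
     = 8%:R * (gcdn N 4 * N)%N%:R^-1 * m%:~R) ->
  exists z : Zp, ratr h = io z.
Proof.
move=> op pN [m hm]; have N0 : (N%:R : rat) != 0.
  by rewrite pnatr_eq0; apply: contraNneq pN => ->; rewrite dvdn0.
have g0 : ((gcdn N 4)%:R : rat) != 0 by rewrite pnatr_eq0 -lt0n gcdn_gt0 orbT.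
pose D := (gcdn N 4 * N ^ 2)%N.
have pD : ~~ (p %| D)%N.
  rewrite Euclid_dvdM // Euclid_dvdX // andbT negb_or pN andbT.
  by apply: contra pN => /dvdn_trans; apply; apply: dvdn_gcdl.
pose m' : int := 8 * N%:Z * m + (gcdn N 4)%:Z * \sum_(j < n) (tnth a j)%:Z * c ^+ 2.
have -> : h = m'%:~R / D%:R; last exact: ratr_padic_int.
rewrite -[h](subrK (\sum_(j < n) (tnth a j)%:R * (c%:~R / N%:R) ^+ 2)) hm /m'.
rewrite -!mulr_suml rmorphD !(rmorphXn, rmorphM) rmorph_sum /= /D.
rewrite -[8%:~R]/(8%:R) -[N%:~R]/(N%:R) -[(gcdn N 4)%:~R]/((gcdn N 4)%:R).
rewrite -[\sum_(i < n) (tnth a i)%:~R]/(\sum_(i < n) (tnth a i)%:R).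
set s := \sum_(i < n) _.
by field; rewrite N0 g0.
Qed.

(** The relation is pulled back from Q_p to Z_p so that it can be reduced modulo [p^(k+1)]. *)
Lemma isometric_diag_padic (d : 'I_n -> Zp) : L_p_isometric_diag v B d ->
  exists2 U : 'M[Zp]_n, U \in unitmx &
    U *m diag_mx (\row_j (tnth a j)%:R) *m U^T = diag_mx (\row_i d i).
Proof.
case=> U uU /= h; exists U => //; apply: map_mx_Zp_to_Qp_inj.
rewrite !map_mxM /= -map_trmx !map_diag_mx /=.
rewrite gram_pE in h; move: h.
have -> : map_mx io (\row_j (tnth a j)%:R) = \row_j (tnth a j)%:R.
  by apply/rowP => j; rewrite !mxE rmorph_nat.
by have -> : map_mx io (\row_i d i) = \row_i io (d i) by apply/rowP => j; rewrite !mxE.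
Qed.

End LocalLattice.

(** * Transport of solution counts along the diagonalizing isometry *)

Lemma diag_formE (K : comNzRingType) n (c : 'I_n -> K) (x : 'rV[K]_n) :
  (x *m diag_mx (\row_j c j) *m x^T) 0 0 = \sum_j c j * x 0 j ^+ 2.
Proof.
rewrite mxE; apply: eq_bigr => j _.
by rewrite mul_mx_diag !mxE mulrAC expr2 mulrC.
Qed.

Lemma card_diag_quadric_isometry (K : finComUnitRingType) n (U : 'M[K]_n)
    (c d : 'I_n -> K) (t : K) :
  U \in unitmx -> U *m diag_mx (\row_j c j) *m U^T = diag_mx (\row_j d j) ->
  (#|[set y : 'rV[K]_n | (\sum_j d j * y 0 j ^+ 2 == t)%R]| <=
   #|[set x : 'rV[K]_n | (\sum_j c j * x 0 j ^+ 2 == t)%R]|)%N.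
Proof.
move=> uU Ucd; rewrite -(card_imset _ (can_inj (mulmxK uU))).
apply/subset_leq_card/fintype.subsetP => _ /imsetP[y + ->]; rewrite !inE => /eqP <-.
by rewrite -!diag_formE -Ucd trmx_mul !mulmxA.
Qed.

Section LocalCount.
Variables (n : nat) (a : 'I_n.+1 -> nat) (p : nat) (hp : prime p).
Local Notation Zp := (padic_int hp).
Variables (U : 'M[Zp]_n.+1) (b : 'I_n.+1 -> Zp) (r : 'I_n.+1 -> nat).
Hypotheses (uU : U \in unitmx) (ub : forall j, b j \is a GRing.unit).
Hypothesis Uab :
  U *m diag_mx (\row_j (a j)%:R) *m U^T = diag_mx (\row_j (b j * p%:R ^+ r j)).
Hypothesis a_pos : forall j, (0 < a j)%N.

(* Compare determinants in [Uab]. *)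
Lemma ppow_exponent_dvd j : (p ^ r j %| \prod_i a i)%N.
Proof.
have := congr1 determinant Uab; rewrite !det_mulmx det_tr !det_diag.
under eq_bigr do rewrite mxE; under [in RHS]eq_bigr do rewrite mxE.
rewrite [RHS](bigD1 j) //= mulrAC -expr2 => e.
have uD : \det U ^+ 2 \is a GRing.unit by rewrite unitrX // -unitmxE.
set z := \prod_(i < n.+1 | i != j) _ in e.
have /dvdz_padic : ((\prod_i a i)%N%:Z)%:~R = p%:R ^+ r j * (b j * z / \det U ^+ 2) :> Zp.
  rewrite -pmulrn natr_prod; apply: (mulrI uD); rewrite e.
  by rewrite [RHS]mulrC -!mulrA mulVr // mulr1 mulrCA.
by rewrite dvdzE.
Qed.

(** From [r < p^r]; this removes the exponents, hence [p], from the final constant. *)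
Lemma exponent_lt_prod j : (r j < \prod_i a i)%N.
Proof.
apply: leq_trans (ltn_expl _ (prime_gt1 hp)) (dvdn_leq _ (ppow_exponent_dvd j)).
by rewrite prodn_gt0.
Qed.

Lemma card_local_solutions_ge k (h : Zp) (i := fun j => inord j : 'I_n.+1)
    (u := padic_residue (b (i 0) * b (i 1))) :
  odd p -> (5 <= n)%N -> (r (i 4) <= k)%N -> r (i 0) = 0%N -> r (i 1) = 0%N ->
  [\/ r (i 2) = 0%N,
      (p %% 4 = 1)%N /\ legendre u = 1 \/ (p %% 4 = 3)%N /\ legendre u = -1 |
      r (i 2) = 1%N /\ r (i 3) = 1%N] ->
  ((p ^ (k - r (i 4))) ^ n <=
    #|[set x : 'rV['Z_(p ^ k.+1)]_n.+1 |
        (\sum_j (a j)%:R * x 0 j ^+ 2 == padic_red k h)%R]|)%N.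
Proof.
move=> op n5 rk r0 r1 H; pose b' j := padic_res (b j) k.+1.
have pb j : ~~ (p %| b' j)%Z by apply: padic_unit_res.
(* The Legendre condition is on p-adic units, while the count uses integer representatives modulo
   [p^(k+1)]; both have the same class modulo [p]. *)
have uE : u = (b' (i 0) * b' (i 1))%:~R.
  have resE1 (x : Zp) : (padic_res x 1)%:~R = (padic_res x k.+1)%:~R :> 'F_p.
    have := res_mod_le x (isT : 1 <= k.+1)%N; rewrite expn1 => /eqP.
    by rewrite eq_sym eqz_mod_dvd (dvdz_Fp _ hp) rmorphB subr_eq0 => /eqP.
  rewrite /u /padic_residue resE1 padic_resM; apply/eqP.
  rewrite -subr_eq0 -rmorphB -dvdz_Fp // -eqz_mod_dvd expnS PoszM.
  by rewrite eqz_mod_dvd (dvdz_trans _ (_ : (p%:Z * (p ^ k)%N%:Z %| _)%Z)) ?dvdz_mulr ?dvdzz //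
    -eqz_mod_dvd modz_mod.
rewrite uE in H.
apply: leq_trans (card_local_quadric_ge (padic_res h k.+1) hp op n5 rk pb r0 r1 H) _.
apply: (card_diag_quadric_isometry (U := map_mx (padic_red k) U)).
  by rewrite unitmxE det_map_mx rmorph_unit -?unitmxE.
have := congr1 (map_mx (padic_red k)) Uab.
rewrite !map_mxM /= -map_trmx !map_diag_mx /=.
have -> : map_mx (@padic_red p hp k) (\row_j (a j)%:R) = \row_(j < n.+1) (a j)%:R.
  by apply/matrixP => l j; rewrite !mxE rmorph_nat.
move=> ->; congr diag_mx; apply/matrixP => l j; rewrite !mxE rmorphM rmorphXn rmorph_nat.
by rewrite !(rmorphXn, rmorphM) /= -pmulrn.
Qed.

End LocalCount.

(** * Integration over p-adic vector spaces *)

Section StepIntegral.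
Local Open Scope classical_set_scope.
Context d (T : measurableType d) (R : realType) (mu : {measure set T -> \bar R}).
Variables (I : finType) (D : I -> set T) (c : I -> R) (m : R).
Hypotheses (mD : forall i, measurable (D i)) (muD : forall i, mu (D i) = m%:E).

Let step (x : T) : R := \sum_i c i * \1_(D i) x.

Let indic_integrable i : mu.-integrable setT (fun x => (\1_(D i) x)%:E).
Proof.
apply/integrableP; split.
  by apply/measurable_EFinP; apply: measurable_indic.
rewrite (eq_integral (fun x => (\1_(D i) x)%:E)); last first.
  by move=> t _; rewrite gee0_abs // lee_fin.
by rewrite integral_indic // setIT [X in (X < _)%E]muD ltry.
Qed.

Let stepE : (fun x => (step x)%:E) = (fun x => (\sum_i (c i)%:E * (\1_(D i) x)%:E)%E).
Proof. by apply/funext => x; rewrite -sumEFin. Qed.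

Lemma integrable_step : mu.-integrable setT (EFin \o step).
Proof.
rewrite /comp stepE; apply: integrable_sum => // i _.
exact: integrableZl.
Qed.

(** Used for cosets of Z_p in Q_p, of mass 1, and for cosets of [p^(k+1) L_p] in [L_p]. *)
Lemma integral_step : (\int[mu]_x (step x)%:E = (m * \sum_i c i)%:E)%E.
Proof.
rewrite stepE integral_sum //; last by move=> i; apply: integrableZl.
rewrite mulr_sumr -sumEFin; apply: eq_bigr => i _.
by rewrite integralZl // integral_indic // setIT [X in (_ * X)%E]muD -EFinM mulrC.
Qed.

Lemma Rintegral_step : \int[mu]_x step x = m * \sum_i c i.
Proof. by rewrite /Rintegral integral_step. Qed.

End StepIntegral.

(** * Haar integrals of Z_p-periodic functions on Q_p *)

Section IntegralQp.
Local Open Scope classical_set_scope.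
Variables (R : realType) (p : nat) (hp : prime p).
Local Notation Zp := (padic_int hp).
Local Notation Qp := (padic hp).
Local Notation io := (@Zp_to_Qp p hp).
Variable mu : {measure set (borel Qp) -> \bar R}.
Hypothesis haar : haar_measure mu +%R (Qp_integers hp).

(** A union of cosets of the open subgroup Z_p is open. *)
Lemma periodic_measurable (P : set Qp) :
  (forall x (z : Zp), P x -> P (x + io z)) -> measurable (P : set (borel Qp)).
Proof.
move=> hP; apply: sub_sigma_algebra.
have oP : Qp_open P by move=> x Px; exists 0%N => z; rewrite expr0 mul1r; apply: hP.
exact: oP.
Qed.

Lemma periodic_measurable_fun (f : Qp -> R) :
  (forall x (z : Zp), f (x + io z) = f x) -> measurable_fun setT (f : borel Qp -> R).
Proof.
move=> hf _ Y _; rewrite setTI; apply: periodic_measurable => x z.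
by rewrite /preimage /= hf.
Qed.

(** The coset [s / p^(k+1) + Z_p]; for varying [s] these partition [p^(-k-1) Z_p]. *)
Definition Qp_coset k (s : 'Z_(p ^ k.+1)) : set Qp :=
  [set x | exists2 w : Zp, x = io w / p%:R ^+ k.+1 & padic_red k w = s].

Lemma Qp_coset_measurable k s : measurable (@Qp_coset k s : set (borel Qp)).
Proof.
apply: periodic_measurable => x z [w -> ws]; exists (w + p%:R ^+ k.+1 * z).
  rewrite rmorphD rmorphM rmorphXn rmorph_nat mulrDl [_ * io z]mulrC mulfK //.
  exact: ppow_Qp_neq0.
by rewrite rmorphD /= padic_red_mulp addr0.
Qed.

Lemma Qp_coset_measure k s : mu (@Qp_coset k s) = 1%E.
Proof.
have [hinv h1] := haar; rewrite -h1 -(hinv _ ((s : nat)%:R / p%:R ^+ k.+1)); last first.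
  by apply: periodic_measurable => _ z [w _ <-]; exists (w + z); rewrite ?rmorphD.
congr (mu _); apply/seteqP; split => [x [w -> ws]|x [_ [w _ <-] <-]].
  have [z wz] : exists z, w - (s : nat)%:R = p%:R ^+ k.+1 * z.
    by apply: padic_red_eq0; rewrite rmorphB /= padic_redK ws subrr.
  exists (io z); first by exists z.
  rewrite -[w](subrK (s : nat)%:R) wz rmorphD rmorphM rmorphXn !rmorph_nat mulrDl addrC.
  by rewrite [_ * io z]mulrC mulfK // ppow_Qp_neq0.
exists ((s : nat)%:R + p%:R ^+ k.+1 * w); last first.
  by rewrite rmorphD /= padic_red_mulp addr0 padic_redK.
rewrite rmorphD rmorphM rmorphXn !rmorph_nat mulrDl [_ * io w]mulrC mulfK //.
exact: ppow_Qp_neq0.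
Qed.

Lemma Qp_coset_periodic (f : Qp -> R) k s x :
  (forall x (z : Zp), f (x + io z) = f x) -> @Qp_coset k s x ->
  f x = f ((s : nat)%:R / p%:R ^+ k.+1).
Proof.
move=> hf [w -> ws].
have [z wz] : exists z, w - (s : nat)%:R = p%:R ^+ k.+1 * z.
  by apply: padic_red_eq0; rewrite rmorphB /= padic_redK ws subrr.
rewrite -[w](subrK (s : nat)%:R) wz rmorphD rmorphM rmorphXn !rmorph_nat mulrDl addrC.
by rewrite [_ * io z]mulrC mulfK ?hf // ppow_Qp_neq0.
Qed.

Lemma Qp_coset_inj k s t x : @Qp_coset k s x -> @Qp_coset k t x -> s = t.
Proof.
move=> [w -> <-] [w' e <-]; congr padic_red; apply: (@Zp_to_Qp_inj p hp).
apply: mulIf e; apply: invr_neq0; exact: ppow_Qp_neq0.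
Qed.

Lemma Qp_coset_near x : exists K, forall k, (K <= k)%N -> exists s, @Qp_coset k s x.
Proof.
have [w [K ->]] := padic_fraction x; exists K => k Kk.
exists (padic_red k (w * p%:R ^+ (k.+1 - K))), (w * p%:R ^+ (k.+1 - K)) => //.
rewrite rmorphM rmorphXn rmorph_nat -{2}(subnK (leqW Kk)) exprD invfM.
by rewrite -mulrA mulVKf ?ppow_Qp_neq0.
Qed.

(** For periodic [f] this is [f] cut off outside [p^(-k-1) Z_p]. *)
Definition Qp_step (f : Qp -> R) k (x : borel Qp) : R :=
  \sum_(s : 'Z_(p ^ k.+1)) f ((s : nat)%:R / p%:R ^+ k.+1) * \1_(Qp_coset s) x.

Lemma Qp_step_in f k s x :
  (forall x (z : Zp), f (x + io z) = f x) -> @Qp_coset k s x -> Qp_step f k x = f x.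
Proof.
move=> hf xs; rewrite /Qp_step (bigD1 s) //= big1 => [|t ts].
  by rewrite indicE mem_set // mulr1 addr0 -(Qp_coset_periodic hf xs).
rewrite indicE memNset ?mulr0 // => xt.
by rewrite (Qp_coset_inj xt xs) eqxx in ts.
Qed.

Lemma Qp_step_out f k x : (forall s, ~ @Qp_coset k s x) -> Qp_step f k x = 0.
Proof. by move=> h; rewrite /Qp_step big1 // => t _; rewrite indicE memNset ?mulr0. Qed.

Lemma Qp_step_dec f k x : (forall x (z : Zp), f (x + io z) = f x) ->
  Qp_step f k x = f x \/ Qp_step f k x = 0.
Proof.
move=> hf; have [[s xs]|h] := pselect (exists s, @Qp_coset k s x).
  by left; apply: Qp_step_in xs.
by right; apply: Qp_step_out => s xs; apply: h; exists s.
Qed.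

Definition Qp_sum (f : Qp -> R) k : R :=
  \sum_(s : 'Z_(p ^ k.+1)) f ((s : nat)%:R / p%:R ^+ k.+1).

Lemma integral_Qp_step f k : (\int[mu]_x (Qp_step f k x)%:E = (Qp_sum f k)%:E)%E.
Proof.
rewrite (integral_step _ (@Qp_coset_measurable k) (@Qp_coset_measure k)).
by rewrite mul1r.
Qed.

Lemma Qp_step_cvg f x : (forall x (z : Zp), f (x + io z) = f x) ->
  (Qp_step f k x)%:E @[k --> \oo] --> (f x)%:E.
Proof.
move=> hf; have [K hK] := Qp_coset_near x; apply: cvg_near_cst.
exists K => // k /= /hK[s xs]; by rewrite (Qp_step_in hf xs).
Qed.

Lemma Qp_step_measurable f k :
  measurable_fun setT (fun x => (Qp_step f k x)%:E).
Proof.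
have := integrable_step (fun s : 'Z_(p ^ k.+1) => f ((s : nat)%:R / p%:R ^+ k.+1))
  (@Qp_coset_measurable k) (@Qp_coset_measure k).
exact: measurable_int.
Qed.

End IntegralQp.

Section IntegralQpLimit.
Local Open Scope classical_set_scope.
Variables (R : realType) (p : nat) (hp : prime p).
Local Notation Zp := (padic_int hp).
Local Notation Qp := (padic hp).
Local Notation io := (@Zp_to_Qp p hp).
Variable mu : {measure set (borel Qp) -> \bar R}.
Hypothesis haar : haar_measure mu +%R (Qp_integers hp).

(** Fatou's lemma for the cut-offs of [|f|], which at each point are eventually equal to [|f|] and
    have integrals at most [C]. *)
Lemma Qp_integrable (f : Qp -> R) (C : R) : (forall x (z : Zp), f (x + io z) = f x) ->
  (forall k, Qp_sum (fun x => `|f x|) k <= C) ->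
  mu.-integrable setT (EFin \o (f : borel Qp -> R)).
Proof.
move=> hf hC; apply/integrableP; split.
  by apply/measurable_EFinP; apply: periodic_measurable_fun.
pose g k x := (Qp_step (fun x => `|f x|) k x)%:E.
have hg x (z : Zp) : `|f (x + io z)| = `|f x| by rewrite hf.
have g0 k x : (0 <= g k x)%E.
  by rewrite lee_fin; have [->|->] := Qp_step_dec k x hg.
apply: (@le_lt_trans _ _ C%:E); last exact: ltry.
rewrite (eq_integral (fun x => limn_einf (g ^~ x))); last first.
  move=> x _; rewrite is_cvg_limn_einfE; last by apply/cvg_ex; eexists; exact: Qp_step_cvg.
  by apply/esym/cvg_lim => //=; exact: Qp_step_cvg.
apply: le_trans (fatou mu measurableT _ _) _.
- by move=> k; exact: (Qp_step_measurable haar).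
- by move=> k x _; apply: g0.
rewrite limn_einf_lim; apply: lime_le; first exact: is_cvg_einfs.
apply: nearW => k; apply: (@le_trans _ _ (\int[mu]_x g k x)%E).
  by apply: ereal_inf_lbound; exists k => /=.
by rewrite [X in (X <= _)%E](integral_Qp_step haar) lee_fin.
Qed.

(** Dominated convergence for the cut-offs, with [|f|] itself as the dominating function. *)
Lemma Qp_sum_cvg (f : Qp -> R) (C : R) : (forall x (z : Zp), f (x + io z) = f x) ->
  (forall k, Qp_sum (fun x => `|f x|) k <= C) ->
  Qp_sum f k @[k --> \oo] --> \int[mu]_x f x.
Proof.
move=> hf hC; have fi := Qp_integrable hf hC.
have [|||||_ _ h] := @dominated_convergence _ (borel Qp) R mu setT measurableT
   (fun k x => (Qp_step f k x)%:E) (fun x => (f x)%:E) (fun x => `|(f x)%:E|%E).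
- by move=> k; exact: (Qp_step_measurable haar).
- by apply/measurable_EFinP; apply: periodic_measurable_fun.
- by apply: aeW => x _; exact: Qp_step_cvg.
- exact: integrable_abse.
- apply: aeW => x k _; have [->|->] := Qp_step_dec k x hf; first by [].
  by rewrite abse0 abse_ge0.
rewrite (_ : Qp_sum f = fine \o (fun k => (Qp_sum f k)%:E)) //.
apply: fine_cvg; rewrite /Rintegral fineK; last exact: integrable_fin_num.
rewrite (_ : (fun k => _) = [sequence \int[mu]_x (Qp_step f k x)%:E]_k)%E //.
by apply/funext => k; apply/esym; exact: (integral_Qp_step haar).
Qed.

End IntegralQpLimit.

(** * Haar integrals of locally constant functions on the lattice *)

Section IntegralLattice.
Local Open Scope classical_set_scope.
Variables (R : realType) (n p : nat) (hp : prime p).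
Local Notation Zp := (padic_int hp).
Local Notation Qp := (padic hp).
Local Notation io := (@Zp_to_Qp p hp).
Variable mu : {measure set (borel 'rV[Qp]_n) -> \bar R}.
Local Notation std_lattice := (range (fun z : 'rV[Zp]_n => map_mx io z)).
Hypothesis haar : haar_measure mu +%R std_lattice.

Definition lattice_coset k (y : 'rV['Z_(p ^ k.+1)]_n) : set 'rV[Qp]_n :=
  [set x | exists2 z : 'rV[Zp]_n, x = map_mx io z & map_mx (padic_red k) z = y].

Let lift k (y : 'rV['Z_(p ^ k.+1)]_n) : 'rV[Zp]_n :=
  map_mx (fun s : 'Z_(p ^ k.+1) => (s : nat)%:R) y.

Let liftK k y : map_mx (padic_red k) (@lift k y) = y.
Proof. by apply/rowP => j; rewrite !mxE padic_redK. Qed.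

Lemma lattice_coset_measurable k y :
  measurable (@lattice_coset k y : set (borel 'rV[Qp]_n)).
Proof.
apply: sub_sigma_algebra; rewrite /= openE => x [z xz zy].
(* Openness in the matrix topology: the box with sides [x_j + p^(k+1) Z_p] stays in the coset. *)
exists (fun i j => [set x i j + p%:R ^+ k.+1 * io u | u in setT]).
  move=> i j; apply: open_nbhs_nbhs; split; last by exists 0; rewrite ?rmorph0 ?mulr0 ?addr0.
  have oP : Qp_open [set x i j + p%:R ^+ k.+1 * io u | u in setT].
    move=> _ [u _ <-]; exists k.+1 => u'; exists (u + u') => //.
    by rewrite rmorphD mulrDr addrA.
  exact: oP.
move=> M hM; have /choice[u hu] (j : 'I_n) : exists u, x ord0 j + p%:R ^+ k.+1 * io u = M ord0 j.
  by have [u _ e] := hM ord0 j; exists u.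
exists (\row_j (z 0 j + p%:R ^+ k.+1 * u j)).
  apply/rowP => j; rewrite !mxE -hu xz mxE.
  by rewrite rmorphD rmorphM rmorphXn rmorph_nat.
apply/rowP => j; rewrite -zy !mxE rmorphD /=.
by rewrite [X in _ + X]padic_red_mulp addr0.
Qed.

Lemma lattice_coset_inj k y y' x :
  @lattice_coset k y x -> @lattice_coset k y' x -> y = y'.
Proof. by move=> [z -> <-] [z' /map_mx_Zp_to_Qp_inj -> <-]. Qed.

Lemma sum_lattice_coset (K : nzRingType) k (g : 'rV['Z_(p ^ k.+1)]_n -> K) z :
  \sum_y g y * \1_(lattice_coset y) (map_mx io z) = g (map_mx (padic_red k) z).
Proof.
have zin : lattice_coset (map_mx (padic_red k) z) (map_mx io z) by exists z.
rewrite (bigD1 (map_mx (padic_red k) z)) //= big1 => [|y yz].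
  by rewrite indicE mem_set // mulr1 addr0.
rewrite indicE memNset ?mulr0 // => yin.
by rewrite (lattice_coset_inj yin zin) eqxx in yz.
Qed.

Lemma sum_lattice_coset_out (K : nzRingType) k (g : 'rV['Z_(p ^ k.+1)]_n -> K) x :
  ~ std_lattice x ->
  \sum_y g y * \1_(lattice_coset y) x = 0.
Proof.
move=> xL; rewrite big1 // => y _; rewrite indicE memNset ?mulr0 //.
by move=> [z xz _]; apply: xL; exists z.
Qed.

Lemma lattice_coset_translate k y : mu (@lattice_coset k y) = mu (@lattice_coset k 0).
Proof.
have [hinv _] := haar; rewrite -(hinv _ (map_mx io (lift y)) (@lattice_coset_measurable k 0)).
congr (mu _); apply/seteqP; split => [x [z -> zy]|_ [_ [z -> z0] <-]].
  exists (map_mx io (z - lift y)); last by rewrite -map_mxD addrC subrK.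
  by exists (z - lift y); rewrite ?raddfB //= liftK zy subrr.
by exists (lift y + z); rewrite ?map_mxD // liftK z0 addr0.
Qed.

Lemma lattice_coset_measure k y :
  mu (@lattice_coset k y) = (((p ^ k.+1) ^ n)%N%:R^-1)%:E.
Proof.
have [_ h1] := haar; set m0 := mu (@lattice_coset k 0).
have LE : std_lattice = \bigcup_y (@lattice_coset k y).
  apply/seteqP; split => [_ [z _ <-]|x [t _ [z -> _]]]; last by exists z.
  by exists (map_mx (padic_red k) z) => //; exists z.
have mL : measurable (std_lattice : set (borel 'rV[Qp]_n)).
  by rewrite LE; apply: fin_bigcup_measurable => // t _; apply: lattice_coset_measurable.
have m0fin : m0 \is a fin_num.
  rewrite ge0_fin_numE; last exact: measure_ge0.
  apply: (le_lt_trans _ (ltry (1 : R))).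
  rewrite -h1; apply: le_measure; rewrite ?inE //; first exact: lattice_coset_measurable.
  by move=> x [z -> _]; exists z.
have mE y' : mu (@lattice_coset k y') = (fine m0)%:E by rewrite fineK // lattice_coset_translate.
(* The cosets partition the lattice, so this step function is its indicator, and
   [1 = m0 * p^((k+1)n)]. *)
have := integral_step (fun=> 1) (@lattice_coset_measurable k) mE.
have cZ : #|{: 'rV['Z_(p ^ k.+1)]_n}| = ((p ^ k.+1) ^ n)%N.
  by rewrite card_mx mul1n card_ord Zp_cast ?ppow_gt1.
rewrite sumr_const cZ.
rewrite (eq_integral (fun x : borel 'rV[Qp]_n => (\1_std_lattice x)%:E)); last first.
  move=> x _; congr EFin; have [[z _ <-]|xL] := pselect (std_lattice x).
    by rewrite sum_lattice_coset indicE mem_set //; exists z.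
  by rewrite sum_lattice_coset_out // indicE memNset.
rewrite integral_indic // setIT [X in X = _]h1 => -[e].
rewrite mE; congr EFin.
have q0 : ((p ^ k.+1) ^ n)%N%:R != 0 :> R by rewrite pnatr_eq0 -lt0n !expn_gt0 prime_gt0.
by apply: (mulIf q0); rewrite mulVf // -e.
Qed.

Lemma complex_integral_lattice k (g : 'rV['Z_(p ^ k.+1)]_n -> R[i]) :
  complex_integral mu (fun x => \sum_y g y * \1_(lattice_coset y) x) =
  ((p ^ k.+1) ^ n)%N%:R^-1 * \sum_y g y.
Proof.
have ReE x : complex.Re (\sum_y g y * \1_(lattice_coset y) x) =
    \sum_y complex.Re (g y) * \1_(lattice_coset y) x.
  rewrite (raddf_sum (@complex.Re R)); apply: eq_bigr => y _.
  by rewrite !indicE; case: (_ \in _); rewrite ?mulr1 ?mulr0.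
have ImE x : complex.Im (\sum_y g y * \1_(lattice_coset y) x) =
    \sum_y complex.Im (g y) * \1_(lattice_coset y) x.
  rewrite (raddf_sum (@complex.Im R)); apply: eq_bigr => y _.
  by rewrite !indicE; case: (_ \in _); rewrite ?mulr1 ?mulr0.
rewrite /complex_integral.
rewrite (_ : (fun x => complex.Re _) =
  fun x => \sum_y complex.Re (g y) * \1_(lattice_coset y) x); last exact/funext.
rewrite (_ : (fun x => complex.Im _) =
  fun x => \sum_y complex.Im (g y) * \1_(lattice_coset y) x); last exact/funext.
rewrite !(Rintegral_step _ (@lattice_coset_measurable k) (@lattice_coset_measure k)).
have -> : ((p ^ k.+1) ^ n)%N%:R^-1 = (((p ^ k.+1) ^ n)%N%:R^-1)%:C%C :> R[i].
  by rewrite fmorphV rmorph_nat.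
rewrite -!raddf_sum; by case: (\sum_y g y) => a b /=; simpc.
Qed.

End IntegralLattice.

(** * The local density *)

Section ShellBound.
Variables (R : realType) (p : nat) (hp : prime p).
Hypothesis op : odd p.
Local Notation Qp := (padic hp).
Variables (f : Qp -> R) (G : R).
Hypothesis G0 : 0 <= G.
Hypothesis fG : forall k i, (i < p ^ k.+1)%N -> ~~ (p %| i)%N ->
  `|f (i%:R / p%:R ^+ k.+1)| <= G / (p ^ k.+1)%:R ^+ 3.

(** The sum over [p^(-k) Z_p / Z_p]; unlike [Qp_sum] it has a level 0, [T 0 = f 0], where the
    telescoping starts. *)
Let T k : R := \sum_(0 <= i < p ^ k) f (i%:R / p%:R ^+ k).

Let Qp_sumE k : Qp_sum f k = T k.+1.
Proof. by rewrite /Qp_sum /T big_mkord Zp_cast ?ppow_gt1. Qed.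

(* The terms with [p %| i] in [T k.+1] add up to [T k]. *)
Let shell k : `|T k.+1 - T k| <= G / 9%:R ^+ k.+1.
Proof.
have -> : T k.+1 = \sum_(0 <= j < p ^ k) \sum_(0 <= l < p) f ((j * p + l)%N%:R / p%:R ^+ k.+1).
  rewrite /T expnSr big_nat_mul; apply: eq_bigr => j _.
  rewrite -{1}[(j * p)%N]add0n mulSn big_addn addnK.
  by apply: eq_bigr => l _; rewrite addnC.
rewrite /T -sumrB; apply: le_trans (ler_norm_sum _ _ _) _.
have P0 : (p%:R : Qp) != 0 by rewrite natr_Qp_eq0 -lt0n prime_gt0.
have pR : 0 < p%:R :> R by rewrite ltr0n prime_gt0.
(* With [q = p^(k+1)], fewer than [q] new terms of size at most [G / q^3] give at most [G / q^2],
   and [q >= 3^(k+1)]. *)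
apply: (@le_trans _ _ (\sum_(0 <= j < p ^ k) p%:R * (G / (p ^ k.+1)%:R ^+ 3))).
  rewrite !big_nat; apply: ler_sum => j /andP[_ jlt].
  rewrite (big_ltn (prime_gt0 hp)) addn0.
  have -> : (j * p)%:R / p%:R ^+ k.+1 = j%:R / p%:R ^+ k :> Qp.
    by rewrite natrM exprSr -mulf_div divff // mulr1.
  rewrite addrC addrA addNr add0r; apply: le_trans (ler_norm_sum _ _ _) _.
  apply: (@le_trans _ _ (\sum_(1 <= l < p) G / (p ^ k.+1)%:R ^+ 3)).
    rewrite big_nat [X in _ <= X]big_nat; apply: ler_sum => l /andP[l0 lp]; apply: fG.
      apply: (@leq_trans (j.+1 * p)); first by rewrite mulSnr ltn_add2l.
      by rewrite expnSr leq_pmul2r ?prime_gt0.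
    by rewrite dvdn_addr ?dvdn_mull // gtnNdvd.
  rewrite sumr_const_nat -[_ *+ _]mulr_natl ler_wpM2r //; last by rewrite ler_nat leq_subr.
  by rewrite divr_ge0 // exprn_ge0.
rewrite sumr_const_nat subn0 -[_ *+ _]mulr_natl.
have -> : (p ^ k)%:R * (p%:R * (G / (p ^ k.+1)%:R ^+ 3)) = G / (p ^ k.+1)%:R ^+ 2 :> R.
  rewrite !natrX [p%:R ^+ k.+1]exprSr; have := pR; rewrite lt0r => /andP[p0 _].
  have k0 : p%:R ^+ k != 0 :> R by rewrite expf_neq0.
  by move: (p%:R ^+ k) k0 => P k0; field; rewrite p0 k0.
rewrite ler_wpM2l // lef_pV2 ?posrE ?exprn_gt0 ?ltr0n ?expn_gt0 ?(prime_gt0 hp) //.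
rewrite natrX -exprM mulnC exprM ler_pXn2r ?nnegrE ?exprn_ge0 //.
rewrite -natrX ler_nat (@leq_exp2r 3 p 2) //.
by have := prime_gt1 hp; case: (p) op => [|[|[|]]].
Qed.

(* [p >= 3], so the shells [|s| = p ^ j] contribute at most [G / 9 ^ j], [j >= 1]. *)
Lemma Qp_sum_shell_bound k : `|Qp_sum f k - f 0| <= G / 8%:R.
Proof.
have -> : f 0 = T 0 by rewrite /T big_nat1 mul0r.
(* The exact value of [9^-1 + ... + 9^-(k+1)] is [(1 - 9^-(k+1)) / 8]; keeping it lets the induction
   close. *)
rewrite Qp_sumE; suff : `|T k.+1 - T 0| <= G / 8%:R * (1 - (9%:R ^+ k.+1)^-1).
  move=> h; apply: le_trans h _; rewrite -[leRHS]mulr1.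
  by rewrite ler_wpM2l ?divr_ge0 // gerBl invr_ge0 exprn_ge0.
elim: k => [|k IH].
  apply: le_trans (shell 0) _; rewrite expr1; lra.
have -> : T k.+2 - T 0 = (T k.+2 - T k.+1) + (T k.+1 - T 0) by ring.
apply: le_trans (ler_normD _ _) _; apply: le_trans (lerD (shell k.+1) IH) _.
rewrite [9%:R ^+ k.+2]exprS invfM.
have : 0 <= (9%:R ^+ k.+1)^-1 :> R by rewrite invr_ge0 exprn_ge0.
move: (_^-1) => z z0; move: G0 => g0; nra.
Qed.

End ShellBound.

Section LocalDensity.
Local Open Scope classical_set_scope.
Variables (R : realType) (V : vectType rat) (B : V -> V -> rat) (n : nat).
Variables (v : n.-tuple V) (a : n.-tuple nat).
Hypothesis v_basis : basis_of fullv v.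
Hypothesis gram : forall i j : 'I_n,
  B (tnth v i) (tnth v j) = if i == j then (tnth a i)%:R else 0.
Hypothesis n_ge6 : (6 <= n)%N.
Variables (p : nat) (hp : prime p).
Hypothesis op : odd p.
Local Notation Zp := (padic_int hp).
Local Notation Qp := (padic hp).
Local Notation io := (@Zp_to_Qp p hp).
Variables (nu : V) (h : rat) (hz : Zp).
Hypothesis Xnu : X_p v nu = L_p v hp.
Hypothesis h_hz : ratr h = io hz.
Variables (muQ : {measure set (borel Qp) -> \bar R}).
Variables (muV : {measure set (borel 'rV[Qp]_n) -> \bar R}).
Hypotheses (haarQ : haar_measure muQ +%R (Qp_integers hp))
  (haarV : haar_measure muV +%R (L_p v hp)).

Let H (s : Qp) : R[i] := complex_integral muV (fun x =>
  e_p R (s * (phi_p v B x - ratr h)) * \1_(X_p v nu) x).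

Let haarV' : haar_measure muV +%R (range (fun z : 'rV[Zp]_n => map_mx io z)).
Proof. by rewrite -(L_pE v_basis). Qed.

(** On [L_p] both [phi] and [h] are p-adic integers, so the argument of [e_p] moves by a p-adic
    integer. *)
Lemma density_periodic s (w : Zp) : H (s + io w) = H s.
Proof.
rewrite /H; congr complex_integral; apply/funext => x.
rewrite Xnu (L_pE v_basis) !indicE.
have [[z _ <-]|xL] := pselect (range (fun z : 'rV[Zp]_n => map_mx io z) x); last first.
  by rewrite memNset // !mulr0.
rewrite (phi_pE gram) h_hz -rmorphB mulrDl -[io w * _]rmorphM.
by rewrite e_p_periodic.
Qed.

Lemma density_value k (s : nat) :
  H (s%:R / p%:R ^+ k.+1) =
  ((p ^ k.+1) ^ n)%N%:R^-1 * quadric_char_sum R (tnth a) (padic_red k hz) s%:R.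
Proof.
rewrite /quadric_char_sum -(complex_integral_lattice haarV').
rewrite /H; congr complex_integral; apply/funext => x.
rewrite Xnu (L_pE v_basis).
have [[z _ <-]|xL] := pselect (range (fun z : 'rV[Zp]_n => map_mx io z) x); last first.
  by rewrite indicE memNset // mulr0 sum_lattice_coset_out.
rewrite sum_lattice_coset indicE mem_set //.
rewrite mulr1 (phi_pE gram) h_hz -rmorphB mulrAC -(rmorph_nat io) -rmorphM e_p_div.
congr psi; rewrite rmorphM rmorph_nat rmorphB rmorph_sum /=; congr (_ * (_ - _)).
by apply: eq_bigr => j _; rewrite rmorphM rmorphXn rmorph_nat mxE.
Qed.

Lemma density_sum k : \sum_(s : 'Z_(p ^ k.+1)) H ((s : nat)%:R / p%:R ^+ k.+1) =
  ((p ^ k.+1)%:R / ((p ^ k.+1) ^ n)%N%:R *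
   #|[set x : 'rV['Z_(p ^ k.+1)]_n |
      (\sum_j (tnth a j)%:R * x 0 j ^+ 2 == padic_red k hz)%R]%SET|%:R : R)%:C%C.
Proof.
under eq_bigr do rewrite density_value natr_Zp.
rewrite -mulr_sumr quadric_char_sum_total ?ppow_gt1 // natrM.
rewrite mulrA [X in X * _]mulrC !rmorphM fmorphV !rmorph_nat /=.
by [].
Qed.

Lemma density0 : H 0 = 1.
Proof.
have := density_value 0 0; rewrite mul0r => ->.
rewrite /quadric_char_sum; under eq_bigr do rewrite mul0r psi0.
rewrite sumr_const card_mx mul1n card_ord Zp_cast ?ppow_gt1 // mulVf //.
by rewrite pnatr_eq0 -lt0n !expn_gt0 prime_gt0.
Qed.

Variable G : nat.
Hypothesis G_gt0 : (0 < G)%N.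
Hypothesis G_gcd : forall k, (\prod_j gcdn (tnth a j) (p ^ k.+1) <= G)%N.

(** The Gauss bound gives [q^(-2n) * q^n * G = G q^(-n)]. Since [G >= 1] and [n >= 6], this is at
    most [(G q^(-3))^2], a square, so no root of [G] has to be taken. *)
Lemma density_decay k (s : nat) : (s < p ^ k.+1)%N -> ~~ (p %| s)%N ->
  complex.Re (H (s%:R / p%:R ^+ k.+1)) ^+ 2 + complex.Im (H (s%:R / p%:R ^+ k.+1)) ^+ 2
    <= (G%:R / (p ^ k.+1)%:R ^+ 3) ^+ 2.
Proof.
move=> sq ps; rewrite -lecR add_Re2_Im2 density_value normrM exprMn.
set q := (p ^ k.+1)%N; have q1 : (1 < q)%N by apply: ppow_gt1.
have q0 : 0 < q%:R :> R[i] by rewrite ltr0n ltnW.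
have unit_coprime m : ~~ (p %| m)%N -> (m%:R : 'Z_q) \is a GRing.unit.
  by move=> pm; rewrite unitZpE // coprimeXl // prime_coprime.
have u2 : (2%:R : 'Z_q) \is a GRing.unit.
  by apply: unit_coprime; rewrite dvdn_prime2 //; apply: contraL op => /eqP ->.
have := quadric_char_sum_norm R (tnth a) (padic_red k hz) q1 (unit_coprime _ ps) u2.
move: (`|quadric_char_sum _ _ _ _| ^+ 2) => X hX.
apply: (@le_trans _ _ (((q ^ n)%N%:R^-1) ^+ 2 * (q ^ n * G)%N%:R)).
  rewrite normfV normr_nat ler_wpM2l ?exprn_ge0 ?invr_ge0 //.
  by apply: le_trans hX _; rewrite ler_nat leq_mul2l G_gcd orbT.
have -> : ((G%:R / q%:R ^+ 3) ^+ 2 : R)%:C%C = (G%:R / q%:R ^+ 3) ^+ 2 :> R[i].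
  by rewrite rmorphXn fmorph_div rmorphXn !rmorph_nat.
rewrite natrM [_^-1 ^+ 2]expr2 -mulrA mulKf; last first.
  by rewrite pnatr_eq0 -lt0n expn_gt0 ltnW.
rewrite exprMn mulrC [G%:R ^+ 2]expr2 -mulrA ler_wpM2l // -exprVn -exprM natrX -exprVn.
rewrite -[leLHS]mul1r ler_pM ?exprn_ge0 ?invr_ge0 ?ler1n ?(ltW q0) //.
apply: ler_wiXn2l n_ge6; first by rewrite invr_ge0 ltW.
by rewrite invf_le1 // ler1n ltnW.
Qed.

Let re s := complex.Re (H s).
Let im s := complex.Im (H s).

Let G_ge0 : 0 <= G%:R :> R. Proof. exact: ler0n. Qed.

Let re_decay k s : (s < p ^ k.+1)%N -> ~~ (p %| s)%N ->
  `|re (s%:R / p%:R ^+ k.+1)| <= G%:R / (p ^ k.+1)%:R ^+ 3.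
Proof.
move=> sq ps; rewrite -(@ler_pXn2r _ 2) ?nnegrE ?divr_ge0 ?exprn_ge0 // real_normK ?num_real //.
by apply: le_trans (density_decay sq ps); rewrite lerDl sqr_ge0.
Qed.

Let im_decay k s : (s < p ^ k.+1)%N -> ~~ (p %| s)%N ->
  `|im (s%:R / p%:R ^+ k.+1)| <= G%:R / (p ^ k.+1)%:R ^+ 3.
Proof.
move=> sq ps; rewrite -(@ler_pXn2r _ 2) ?nnegrE ?divr_ge0 ?exprn_ge0 // real_normK ?num_real //.
by apply: le_trans (density_decay sq ps); rewrite lerDr sqr_ge0.
Qed.

Let Qp_sum_norm_le (f : Qp -> R) :
  (forall k s, (s < p ^ k.+1)%N -> ~~ (p %| s)%N ->
    `|f (s%:R / p%:R ^+ k.+1)| <= G%:R / (p ^ k.+1)%:R ^+ 3) ->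
  forall k, Qp_sum (fun s => `|f s|) k <= `|f 0| + G%:R / 8%:R.
Proof.
move=> fG k; rewrite -lerBlDl; apply: le_trans (ler_norm _) _.
by apply: (Qp_sum_shell_bound op) => // l s sq ps; rewrite normr_id; apply: fG.
Qed.

Lemma density_re_cvg : Qp_sum re k @[k --> \oo] --> \int[muQ]_s re s.
Proof.
apply: (Qp_sum_cvg haarQ) (Qp_sum_norm_le re_decay) => s z.
by rewrite /re density_periodic.
Qed.

Lemma density_im_cvg : Qp_sum im k @[k --> \oo] --> \int[muQ]_s im s.
Proof.
apply: (Qp_sum_cvg haarQ) (Qp_sum_norm_le im_decay) => s z.
by rewrite /im density_periodic.
Qed.

Lemma density_sum_re k : Qp_sum re k = (p ^ k.+1)%:R / ((p ^ k.+1) ^ n)%N%:R *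
   #|[set x : 'rV['Z_(p ^ k.+1)]_n |
      (\sum_j (tnth a j)%:R * x 0 j ^+ 2 == padic_red k hz)%R]%SET|%:R.
Proof.
have := congr1 (@complex.Re R) (density_sum k).
by rewrite (raddf_sum (@complex.Re R)).
Qed.

Lemma density_sum_im k : Qp_sum im k = 0.
Proof.
have := congr1 (@complex.Im R) (density_sum k).
by rewrite (raddf_sum (@complex.Im R)).
Qed.

(** Every finite sum is a scaled solution count, so its imaginary part is 0, and so is the limit.
    The order on [R[i]] compares only numbers with equal imaginary parts. *)
Lemma local_density_real :
  local_density v B muQ muV nu h = (\int[muQ]_s re s)%:C%C.
Proof.
rewrite /local_density {1}/complex_integral; congr Complex.
have := density_im_cvg; rewrite (_ : Qp_sum im = fun=> 0); last first.
  by apply/funext => k; apply: density_sum_im.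
move=> c; apply/esym; exact: (cvg_unique _ (cvg_cst _) c).
Qed.

Lemma density_near_1 : `|\int[muQ]_s re s - 1| <= G%:R / 8%:R.
Proof.
have re0 : re 0 = 1 by rewrite /re density0.
have c : `|Qp_sum re k - 1| @[k --> \oo] --> `|\int[muQ]_s re s - 1|.
  by apply: cvg_norm; apply: cvgB; [exact: density_re_cvg|exact: cvg_cst].
rewrite -(cvg_lim _ c) //; apply: limr_le; first by apply/cvg_ex; eexists; exact: c.
by apply: nearW => k; rewrite -[X in `|_ - X|]re0; exact: (Qp_sum_shell_bound op G_ge0 re_decay).
Qed.

Lemma density_ge (c : R) K :
  (forall k, (K <= k)%N -> c * ((p ^ k.+1) ^ n)%N%:R <= (p ^ k.+1)%:R *
    #|[set x : 'rV['Z_(p ^ k.+1)]_n |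
      (\sum_j (tnth a j)%:R * x 0 j ^+ 2 == padic_red k hz)%R]%SET|%:R) ->
  c <= \int[muQ]_s re s.
Proof.
move=> hc; rewrite -(cvg_lim _ density_re_cvg) //.
apply: limr_ge; first by apply/cvg_ex; eexists; exact: density_re_cvg.
exists K => // k /= Kk; rewrite density_sum_re mulrAC ler_pdivlMr ?hc //.
by rewrite ltr0n !expn_gt0 prime_gt0.
Qed.

End LocalDensity.

(** * Uniform constants *)

Lemma shape_exponents (n p : nat) (u : 'F_p) (r : n.+1.-tuple nat) : (5 <= n)%N ->
  [\/ exists i : nat, take 4 r = [:: 0; 0; 0; i]%N,
      exists i j : nat,
        [/\ (1 <= i <= j)%N, take 4 r = [:: 0; 0; i; j]%N &
          (p %% 4 = 1)%N /\ legendre u = 1 \/ (p %% 4 = 3)%N /\ legendre u = -1] |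
      take 4 r = [:: 0; 0; 1; 1]%N /\
        ((p %% 4 = 1)%N /\ legendre u = -1 \/ (p %% 4 = 3)%N /\ legendre u = 1)] ->
  [/\ tnth r (inord 0) = 0%N, tnth r (inord 1) = 0%N &
    [\/ tnth r (inord 2) = 0%N,
        (p %% 4 = 1)%N /\ legendre u = 1 \/ (p %% 4 = 3)%N /\ legendre u = -1 |
        tnth r (inord 2) = 1%N /\ tnth r (inord 3) = 1%N]].
Proof.
move=> n5; have rE j : (j < 4)%N -> tnth r (inord j) = nth 0%N (take 4 r) j.
  by move=> j4; rewrite (tnth_nth 0%N) nth_take // inordK //; lia.
rewrite !rE //; case=> [[i ->]|[i [j [_ -> hu]]]|[-> _]]; split=> //.
- by constructor 1.
- by constructor 2.
- by constructor 3.
Qed.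

Theorem theorem3p5 (R : realType) (V : vectType rat)
    (B : {bilinear V -> V -> rat^o}) (n : nat) (v : n.-tuple V)
    (a : n.-tuple nat)
    (B_sym : forall x y : V, B x y = B y x)
    (B_pos : forall x : V, x != 0 -> (0 : rat) < B x x)
    (v_basis : basis_of fullv v)
    (n_even : ~~ odd n) (n_ge6 : (6 <= n)%N)
    (gram : forall i j : 'I_n,
        B (tnth v i) (tnth v j) = if i == j then (tnth a i)%:R else 0)
    (a_pos : forall j : 'I_n, (0 < tnth a j)%N)
    (a_gcd : (\big[gcdn/0]_(j < n) tnth a j)%N = 1%N) :
  exists c1 c2 : R, [/\ 0 < c1, 0 < c2 &
    forall (c : int) (N : nat) (h : rat) (p : nat) (hp : prime p)
      (b : n.-tuple (padic_int hp)) (r : n.-tuple nat)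
      (muQ : {measure set (borel (padic hp)) -> \bar R})
      (muV : {measure set (borel 'rV[padic hp]_n) -> \bar R}),
    let nu : V := - (c%:~R / N%:R) *: \sum_(j < n) tnth v j in
    (0 < N)%N ->
    coprime `|c|%N N ->
    h != 0 ->
    (exists m : int,
       h - \sum_(j < n) (tnth a j)%:R * (c%:~R / N%:R) ^+ 2
       = 8%:R * (gcdn N 4 * N)%N%:R^-1 * m%:~R) ->
    odd p ->
    ~~ (p %| N)%N ->
    (forall i : 'I_n, tnth b i \is a GRing.unit) ->
    sorted leq r ->
    L_p_isometric_diag v B (fun i => tnth b i * p%:R ^+ tnth r i) ->
    [\/ exists i : nat, take 4 r = [:: 0; 0; 0; i]%N,
        exists i j : nat,
          [/\ (1 <= i <= j)%N, take 4 r = [:: 0; 0; i; j]%N &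
            (p %% 4 = 1)%N /\ legendre (padic_residue (b`_0 * b`_1)) = 1 \/
            (p %% 4 = 3)%N /\ legendre (padic_residue (b`_0 * b`_1)) = -1] |
        take 4 r = [:: 0; 0; 1; 1]%N /\
          ((p %% 4 = 1)%N /\ legendre (padic_residue (b`_0 * b`_1)) = -1 \/
           (p %% 4 = 3)%N /\ legendre (padic_residue (b`_0 * b`_1)) = 1)] ->
    haar_measure muQ +%R (Qp_integers hp) ->
    haar_measure muV +%R (L_p v hp) ->
    (c1%:C <= local_density v B muQ muV nu h <= c2%:C)%C].
Proof.
case: n v a v_basis n_even n_ge6 gram a_pos a_gcd => [|n] // v a v_basis _ n_ge6 gram a_pos _.
pose A := (\prod_j tnth a j)%N; have A0 : (0 < A)%N by rewrite prodn_gt0.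
have AR : 0 < A%:R :> R by rewrite ltr0n.
have E0 : 0 < (A ^ (A * n))%:R :> R by rewrite ltr0n expn_gt0 A0.
(* Here [n] is the rank minus one. The power of [A] serves the primes dividing [A]; the factor 1/2
   serves the others, where the density is at least 7/8 but the power of [A] may be 1. *)
exists ((A ^ (A * n))%:R^-1 / 2%:R), (1 + A%:R); split.
- by rewrite divr_gt0 // invr_gt0.
- by rewrite addr_gt0.
move=> c N h p hp b r muQ muV nu _ _ _ hh op pN ub _ Lb shape haarQ haarV.
have Xnu : X_p v nu = L_p v hp by apply: X_pE.
have [hz h_hz] := coset_value_padic hp op pN hh.
pose G := if (p %| A)%N then A else 1%N.
have G0 : (0 < G)%N by rewrite /G; case: ifP.
have Ggcd k : (\prod_j gcdn (tnth a j) (p ^ k.+1) <= G)%N.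
  rewrite /G; case: ifPn => pA.
    by apply: leq_prod => j _; apply: dvdn_leq (dvdn_gcdl _ _).
  rewrite big1 // => j _; apply/eqP; rewrite -/(coprime _ _) coprime_sym coprimeXl //.
  by rewrite prime_coprime //; apply: contra pA => paj; rewrite /A (bigD1 j) //= dvdn_mulr.
rewrite (local_density_real v_basis gram n_ge6 op Xnu h_hz haarQ haarV G0 Ggcd) !lecR.
have := density_near_1 v_basis gram n_ge6 op Xnu h_hz haarQ haarV G0 Ggcd.
set I := (\int[muQ]_s _); rewrite ler_distl => /andP[Ilo Ihi].
have GA : G%:R <= A%:R :> R by rewrite ler_nat /G; case: ifP.
apply/andP; split; last by apply: le_trans Ihi _; lra.
have E1 : (A ^ (A * n))%:R^-1 <= 1 :> R.
  by rewrite invf_le1 // ler1n expn_gt0 A0.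
have E0' : 0 < (A ^ (A * n))%:R^-1 :> R by rewrite invr_gt0.
have [pA|pA] := boolP (p %| A)%N; last first.
  by rewrite /G (negbTE pA) in Ilo; apply: le_trans Ilo; lra.
have [U uU hU] := isometric_diag_padic gram Lb.
have n5 : (5 <= n)%N by [].
have bE j : (j < 2)%N -> b`_j = tnth b (inord j).
  by move=> j2; rewrite (tnth_nth 0) inordK //; lia.
rewrite !bE // in shape.
have [r0 r1 r23] := shape_exponents n5 shape.
have rA := exponent_lt_prod uU hU a_pos (inord 4).
have pA' : (p <= A)%N by apply: dvdn_leq.
apply: (density_ge v_basis gram n_ge6 op Xnu h_hz haarQ haarV G0 Ggcd (K := tnth r (inord 4))).
move=> k rk.
have := card_local_solutions_ge uU ub hU hz op n5 rk r0 r1 r23.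
set M := #|_|; move: rk rA; set rho := tnth r _ => rk rA hM.
apply: (@le_trans _ _ ((p ^ k.+1)%:R * ((p ^ (k - rho)) ^ n)%:R)); last first.
  by rewrite ler_wpM2l // ler_nat.
(* Dividing the count by this leaves [p^(-(rho+1)n)], where [p <= A] and [rho + 1 <= A]. *)
have -> : ((p ^ k.+1) ^ n.+1 = (p ^ k.+1) * ((p ^ (k - rho)) ^ n * (p ^ rho.+1) ^ n))%N.
  by rewrite expnS -expnMn -expnD addnS subnK.
rewrite !natrM mulrCA ler_wpM2l // mulrCA ler_piMr // mulrAC ler_pdivrMr //.
apply: (@le_trans _ _ 1); last by rewrite mul1r ler1n.
rewrite mulrC ler_pdivrMr // mul1r ler_nat -expnM.
apply: (@leq_trans (A ^ (rho.+1 * n))); first by rewrite leq_exp2r // muln_gt0; lia.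
by rewrite leq_pexp2l // leq_mul2r rA orbT.
Qed.
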